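(* There exist a Cantor set $C\subset\overline{\mathbb C}$ with Hausdorff dimension $\dim_H(C)=0$ and a proper holomorphic embedding $\gamma\colon\overline{\mathbb C}\setminus C\hookrightarrow\mathbb C^2$.
   Context: $\overline{\mathbb C}=\mathbb C\cup\{\infty\}$ is the Riemann sphere, equipped with the spherical (chordal-angle) metric $d(x,y)=\arccos(\varphi(x)\cdot\varphi(y))$, where $\varphi$ is the stereographic projection onto the unit sphere $\mathbb S^2\subset\mathbb R^3$; Hausdorff measures and dimension are taken with respect to this metric. A Cantor set is a subset homeomorphic to the classical middle-thirds Cantor set (equivalently: nonempty, compact, perfect, totally disconnected, metrizable). *)

(* Defs.v *)
From HB Require Import structures.
From mathcomp Require Import all_boot all_order all_algebra.
From mathcomp Require Import complex.
From mathcomp Require Import all_classical all_reals all_analysis.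
Import Order.TTheory GRing.Theory Num.Theory.
Import numFieldNormedType.Exports.
Set Implicit Arguments.
Unset Strict Implicit.
Unset Printing Implicit Defensive.
Local Open Scope classical_set_scope.
Local Open Scope ring_scope.

(** The complex plane C = R[i], viewed as a normed module over itself,
    so that [derivable] / ['D_1] are complex derivatives. *)
Definition CC (R : realType) : normedModType (R[i] : numFieldType) :=
  (R[i] : numFieldType)^o.

(** The Riemann sphere: [Some z] is the point z of C, [None] is infinity. *)
Definition sphere (R : realType) : Type := option R[i].
HB.instance Definition _ (R : realType) := Choice.on (sphere R).

Section RiemannSphere.
Variable R : realType.

Definition stereo (x : sphere R) : R * R * R :=
  match x with
  | None => (0, 0, 1)
  | Some z =>
      let a := complex.Re z in let b := complex.Im z in
      let n := a ^+ 2 + b ^+ 2 in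
      ((2 * a) / (1 + n), (2 * b) / (1 + n), (n - 1) / (n + 1))
  end.

Definition dot3 (u v : R * R * R) : R :=
  u.1.1 * v.1.1 + u.1.2 * v.1.2 + u.2 * v.2.

Definition sdist (x y : sphere R) : R := acos (dot3 (stereo x) (stereo y)).

Definition sopen (U : set (sphere R)) : Prop :=
  forall x, U x -> exists2 e : R, 0 < e & forall y, sdist x y < e -> U y.

Lemma sopenT : sopen setT.
Proof. by move=> x _; exists 1. Qed.

Lemma sopenI : setI_closed sopen.
Proof.
move=> A B oA oB x [Ax Bx].
have [e1 e10 h1] := oA x Ax; have [e2 e20 h2] := oB x Bx.
exists (Num.min e1 e2); first by rewrite lt_min e10 e20.
move=> y; rewrite lt_min => /andP[y1 y2]; split; [exact: h1|exact: h2].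
Qed.

Lemma sopen_bigU (I : Type) (f : I -> set (sphere R)) :
  (forall i, sopen (f i)) -> sopen (\bigcup_i f i).
Proof.
move=> hf x [i _ fxi]; have [e e0 h] := hf i x fxi.
by exists e => // y /h fiy; exists i.
Qed.

End RiemannSphere.

HB.instance Definition _ (R : realType) :=
  isOpenTopological.Build (sphere R) (@sopenT R) (@sopenI R) (@sopen_bigU R).

Section Defs.
Variable R : realType.

(** Spherical diameter (sup of distances; the sup of the empty set is
    never used, see [hterm]). *)
Definition sdiam (A : set (sphere R)) : R :=
  sup [set d | exists x y, A x /\ A y /\ d = sdist x y].

(** diam(U)^s, with the usual convention that the empty set contributes 0. *)
Definition hterm (s : R) (U : set (sphere R)) : R :=
  if `[< U = set0 >] then 0 else sdiam U `^ s.

Definition hausdorff_delta (s delta : R) (A : set (sphere R)) : \bar R :=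
  ereal_inf [set (\sum_(0 <= n <oo) (hterm s (U n))%:E)%E |
             U in [set U : nat -> set (sphere R) |
                   A `<=` \bigcup_n U n /\ forall n, sdiam (U n) <= delta]].

Definition hausdorff_measure (s : R) (A : set (sphere R)) : \bar R :=
  ereal_sup [set hausdorff_delta s delta A | delta in [set d : R | 0 < d]].

Definition hausdorff_dim (A : set (sphere R)) : \bar R :=
  ereal_inf [set s%:E | s in [set s : R | 0 <= s /\ hausdorff_measure s A = 0%E]].

(** A Cantor set: a subset homeomorphic to the Cantor space {0,1}^N
    (which is homeomorphic to the middle-thirds Cantor set). *)
Definition cantor_set (C : set (sphere R)) : Prop :=
  exists f : cantor_space -> sphere R,
    [/\ continuous f, injective f, range f = C &
        exists g : sphere R -> cantor_space,
          {within C, continuous g} /\ (forall t, g (f t) = t)].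

Definition at_infty (T : Type) (F : sphere R -> T) : CC R -> T :=
  fun w => F (if w == 0 then None else Some (w^-1 : R[i])).

Definition holomorphic_on (Om : set (sphere R)) (F : sphere R -> CC R) : Prop :=
  (forall z : CC R, Om (Some z) -> derivable (fun w : CC R => F (Some w)) z 1)
  /\ (Om None -> derivable (at_infty F) 0 1).

Definition proper_holomorphic_embedding (Om : set (sphere R))
    (gamma : sphere R -> CC R * CC R) : Prop :=
  let g1 := fun x => (gamma x).1 in
  let g2 := fun x => (gamma x).2 in
  [/\ holomorphic_on Om g1 /\ holomorphic_on Om g2,
      (forall x y, Om x -> Om y -> gamma x = gamma y -> x = y),
      (forall z : CC R, Om (Some z) ->
          'D_1 (fun w : CC R => g1 (Some w)) z != 0 \/
          'D_1 (fun w : CC R => g2 (Some w)) z != 0)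
      /\ (Om None -> 'D_1 (at_infty g1) 0 != 0 \/ 'D_1 (at_infty g2) 0 != 0) &
      forall K : set (CC R * CC R), compact K -> compact (Om `&` gamma @^-1` K)].

End Defs.

(* Main.v *)
Require Import Defs.
From HB Require Import structures.
From mathcomp Require Import all_boot all_order all_algebra.
From mathcomp Require Import complex.
From mathcomp Require Import all_classical all_reals all_analysis.
From mathcomp Require Import ring lra.
Import Order.TTheory GRing.Theory Num.Theory.
Import numFieldNormedType.Exports.
Local Open Scope classical_set_scope.
Local Open Scope ring_scope.
Set Implicit Arguments.
Unset Strict Implicit.

(** Start from the line [z |-> (z, 0)], whose only end is at infinity, and apply
    successive birational shears of C^2.  At step k put [f = X + k Y] and replace
    [(X, Y)] by [(X - k h, Y + h)] with [h = eps / (f - a)].  Every puncture is a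
    simple pole of [X + j Y] for all [j >= k]; hence, for [a] large, [f = a] has
    exactly one solution, a simple one, near each puncture, and these solutions
    are the new punctures: each puncture splits into two nearby ones.  Since [f]
    itself is unchanged by the shear, injectivity and immersivity persist, and
    [f] remains large on the small discs around the old punctures, which gives
    properness in the limit.  Taking [eps] tiny makes the maps converge, together
    with their difference quotients, off a Cantor set of punctures and their
    limits, and shrinking the discs fast enough makes its dimension zero.
    Infinity is a puncture from the start, so it lies in the Cantor set.

    Strict differentiability, i.e. convergence of [(f u - f v) / (u - v)] as
    [(u, v)] tends to [(z, z)], replaces Cauchy's theory: it is stable under
    limits that are locally small in Lipschitz norm, and a lower Lipschitz bound
    encodes injectivity and immersivity at once. *)

(** * The complex modulus *)

Section Modulus.
Variable R : realType.
Implicit Types (x y z : R[i]) (r e : R).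

Definition cmod z : R := Normc.normc z.

Lemma normr_cmod z : `|z| = (cmod z)%:C%C. Proof. by []. Qed.

Lemma cmod_ge0 z : 0 <= cmod z.
Proof. by rewrite -ler0c -normr_cmod normr_ge0. Qed.

Lemma cmod0 : cmod 0 = 0. Proof. exact: Normc.normc0. Qed.
Lemma cmodM x y : cmod (x * y) = cmod x * cmod y.
Proof. exact: Normc.normcM. Qed.
Lemma cmodV x : cmod x^-1 = (cmod x)^-1. Proof. exact: Normc.normcV. Qed.
Lemma cmodN x : cmod (- x) = cmod x. Proof. exact: (@normcN R). Qed.
Lemma cmodD x y : cmod (x + y) <= cmod x + cmod y.
Proof. exact: (@le_normcD R). Qed.
Lemma cmodB x y : cmod (x - y) <= cmod x + cmod y.
Proof. by rewrite -(cmodN y) cmodD. Qed.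
Lemma cmodBC x y : cmod (x - y) = cmod (y - x).
Proof. by rewrite -cmodN opprB. Qed.
Lemma cmod_eq0 z : (cmod z == 0) = (z == 0).
Proof.
by apply/eqP/eqP => [/Normc.eq0_normc //|->]; rewrite cmod0.
Qed.
Lemma cmod_gt0 z : (0 < cmod z) = (z != 0).
Proof. by rewrite lt_def cmod_ge0 andbT cmod_eq0. Qed.
Lemma cmodR r : cmod r%:C%C = `|r|.
Proof. by rewrite /cmod /= expr0n addr0 sqrtr_sqr. Qed.
Lemma cmod_nat n : cmod n%:R = n%:R.
Proof. by rewrite -(rmorph_nat (real_complex R)) cmodR normr_nat. Qed.
Lemma cmodBD x y z : cmod (x - z) <= cmod (x - y) + cmod (y - z).
Proof. by rewrite -[x - z](subrKA y) cmodD. Qed.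
Lemma cmod_sub_ge x y : cmod x - cmod y <= cmod (x - y).
Proof. by rewrite lerBlDr -{1}[x](subrK y) cmodD. Qed.

Lemma near0rP (P : R -> Prop) :
  (\forall r \near 0^'+, P r) <->
  exists2 r0, 0 < r0 & forall r, 0 < r < r0 -> P r.
Proof.
split=> [[r0 /= r00 h]|[r0 r00 h]].
  exists r0 => // r /andP[r1 r2]; apply: h => //=.
  by rewrite sub0r normrN gtr0_norm.
near=> r; apply: h; apply/andP; split; first by near: r; exact: nbhs_right_gt.
by near: r; exact: nbhs_right_lt.
Unshelve. all: by end_near. Qed.

Lemma ler_addr_near0 (a b : R) :
  (\forall e \near 0^'+, a <= b + e) -> a <= b.
Proof.
move/near0rP => [r0 r00 h]; apply/ler_addgt0Pl => e e0; rewrite addrC.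
have [lt|ge] := ltP e r0; first by apply: h; rewrite e0.
have := h (r0 / 2); lra.
Qed.

Lemma nbhsCP (z : CC R) (A : set (CC R)) :
  nbhs z A <-> exists2 e : R, 0 < e & forall y : R[i], cmod (y - z) < e -> A y.
Proof.
split=> [/nbhs_normP [e /= e0 h]|[e e0 h]].
  (* Radii of balls in [CC R] are elements of [R[i]]; a positive one is real, hence equals its real
     part. *)
  have ee : e = (complex.Re e)%:C%C by rewrite RRe_real// gtr0_real.
  exists (complex.Re e) => [|y yz]; first by rewrite -ltcR -ee.
  by apply: h; rewrite /= ee normr_cmod ltcR cmodBC.
apply/nbhs_normP; exists (e%:C%C) => /=; first by rewrite ltcR.
by move=> y /=; rewrite normr_cmod ltcR cmodBC => /h.
Qed.

Lemma continuousCP (f : CC R -> CC R) (z : CC R) :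
  {for z, continuous f} <->
  forall e : R, 0 < e -> exists2 r : R, 0 < r &
    forall y : R[i], cmod (y - z) < r -> cmod (f y - f z) < e.
Proof.
split=> [cf e e0|h A /nbhsCP [e e0 eA]].
  have : nbhs (f z) [set y : CC R | cmod (y - f z) < e].
    by apply/nbhsCP; exists e.
  by move/cf => /nbhsCP.
by apply/nbhsCP; have [r r0 rh] := h e e0; exists r => // y /rh /eA.
Qed.

Lemma continuous_cmod : continuous (fun z : CC R => cmod z).
Proof.
move=> z A [e /= e0 eA]; apply/nbhsCP; exists e => // y yz; apply: eA => /=.
apply: le_lt_trans yz; rewrite ler_norml.
have := cmod_sub_ge y z; have := cmod_sub_ge z y; rewrite (cmodBC z y); lra.
Qed.

(** The disc is a closed subset of the continuous image of the compact square [[-r, r]^2]. *)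
Lemma compact_cdisc r : compact [set z : CC R | cmod z <= r].
Proof.
pose T : set (R * R) := `[-r, r] `*` `[-r, r].
have cT : compact T by apply: compact_setX; exact: segment_compact.
pose f (x : R * R) : CC R := Complex x.1 x.2.
have cf : continuous f.
  move=> [a b] A /nbhsCP [e e0 eA].
  have e20 : 0 < e / 2 by lra.
  exists (ball a (e / 2), ball b (e / 2)); first by split; exact: nbhsx_ballx.
  move=> [c d] [] /=; rewrite -!ball_normE /= => ac bd.
  apply: eA.
  have -> : f (c, d) - f (a, b) = (c - a)%:C%C + 'i%C * (d - b)%:C%C.
    by rewrite /f /=; apply/eqP; rewrite eq_complex /=; apply/andP; split;
       apply/eqP; ring.
  apply: le_lt_trans (cmodD _ _) _; rewrite cmodM !cmodR.
  have -> : cmod 'i%C = 1 by rewrite /cmod /= expr0n expr1n add0r sqrtr1.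
  by rewrite mul1r (distrC c) (distrC d); lra.
have cI := @continuous_compact _ _ _ T (continuous_subspaceT cf) cT.
refine (subclosed_compact _ cI _).
  move=> z cz /=; rewrite leNgt; apply/negP => rz.
  have e0 : 0 < cmod z - r by lra.
  have /cz [y [/= y1 y2]] : nbhs z [set y : CC R | cmod (y - z) < cmod z - r].
    by apply/nbhsCP; exists (cmod z - r).
  by have := cmod_sub_ge z y; rewrite cmodBC; lra.
move=> z /= zr; have rr : 0 <= r by apply: le_trans zr; exact: cmod_ge0.
have hle (a b : R) : `|a| <= Num.sqrt (a ^+ 2 + b ^+ 2).
  by rewrite -sqrtr_sqr ler_wsqrtr // lerDl sqr_ge0.
move: zr; case: z => a b; rewrite /cmod /= => zr.
exists (a, b) => //; split => /=; rewrite in_itv /= -ler_norml.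
  by apply: le_trans zr; exact: hle.
by apply: le_trans zr; rewrite addrC; exact: hle.
Qed.

(** From index [k] on the sequence stays in a compact disc, and a cluster point inherits each closed
    condition [cmod (_ - u m) <= e m]. *)
Lemma cauchy_limit (u : nat -> R[i]) (e : nat -> R) (k : nat) :
  (forall m n, (k <= m)%N -> (m <= n)%N -> cmod (u n - u m) <= e m) ->
  exists l, forall m, (k <= m)%N -> cmod (l - u m) <= e m.
Proof.
move=> h.
pose F : set_system (CC R) := (u : nat -> CC R) @ \oo.
have FF : ProperFilter F by apply: fmap_proper_filter.
have hF : F [set z : CC R | cmod z <= cmod (u k) + e k].
  exists k => // n /= kn; have := h k n (leqnn k) kn.
  by have := cmod_sub_ge (u n) (u k); lra.
have [l [_ cl]] := compact_cdisc FF hF.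
exists l => m km; apply: ler_addr_near0; near=> d.
have d0 : 0 < d by near: d; exact: nbhs_right_gt.
have [y [/= y1 y2]] : [set z : CC R | cmod (z - u m) <= e m]
   `&` [set z : CC R | cmod (z - l) < d] !=set0.
  apply: cl; first by exists m => // n /= mn; exact: h.
  by apply/nbhsCP; exists d.
have := cmodBD l y (u m); rewrite (cmodBC l y); lra.
Unshelve. all: by end_near. Qed.

End Modulus.
Arguments near0rP {R P}.
Arguments cmod : simpl never.

(** * Strict differentiability *)

Section StrictDerivative.
Variable K : numFieldType.
Implicit Types (f g : K -> K) (z d : K).

(** Strict derivative in Caratheodory's form: [Q] is a difference quotient with a limit at [(z, z)]
    along all pairs, diagonal ones included. The equation is free of division, so the calculus rules
    reduce to algebra of limits. *)
Definition sdif f z d := exists2 Q : K * K -> K,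
  \forall x \near (z, z), f x.1 - f x.2 = Q x * (x.1 - x.2) &
  Q x @[x --> (z, z)] --> d.

Lemma cvg_pair_nbhs (T : Type) (F : set_system T) {FF : Filter F} (f g : T -> K) (a b : K) :
  f x @[x --> F] --> a -> g x @[x --> F] --> b -> (f x, g x) @[x --> F] --> (a, b).
Proof.
move=> cf cg A [[B1 B2] [/= n1 n2] s].
have h1 : F [set x | B1 (f x)] by exact: cf.
have h2 : F [set x | B2 (g x)] by exact: cg.
suff: F [set x | A (f x, g x)] by [].
by apply: filterS2 h1 h2 => x b1 b2; apply: s; split.
Qed.

Lemma cvg_cstK (T : Type) (F : set_system T) {FF : Filter F} (z : K) :
  (fun=> z) x @[x --> F] --> z.
Proof.
move=> A /nbhs_singleton Az; suff: F [set _ | A z] by [].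
exact: filterE.
Qed.

Lemma sdif_continuous f z d : sdif f z d -> {for z, continuous f}.
Proof.
case=> Q hQ cQ.
have cz : (x, z) @[x --> z] --> (z, z).
  apply: (@cvg_pair_nbhs _ (nbhs z) _ id (fun=> z)); last exact: cvg_cstK.
  by move=> A.
have h : \forall x \near z, f z + Q (x, z) * (x - z) = f x.
  have h0 : \forall x \near z, f x - f z = Q (x, z) * (x - z) by exact: (cz _ hQ).
  by apply: filterS h0 => x <-; ring.
have E : f z + Q (x, z) * (x - z) @[x --> z] --> f z + d * (z - z).
  have c1 : x - z @[x --> z] --> z - z.
    exact: (cvgB (@cvg_id _ (nbhs z)) (@cvg_cstK _ (nbhs z) _ z)).
  have c2 : Q (x, z) @[x --> z] --> d.
    exact: (cvg_comp (fun x => (x, z)) Q cz cQ).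
  exact: (cvgD (@cvg_cstK _ (nbhs z) _ (f z)) (cvgM c2 c1)).
rewrite subrr mulr0 addr0 in E.
exact: (cvg_trans (near_eq_cvg h) E).
Qed.

Lemma cvg_fst_diag z : x.1 @[x --> (z, z)] --> z.
Proof. exact: cvg_fst. Qed.

Lemma cvg_snd_diag z : x.2 @[x --> (z, z)] --> z.
Proof. exact: cvg_snd. Qed.

Lemma sdif_near f g z d : (\forall x \near z, f x = g x) -> sdif f z d -> sdif g z d.
Proof.
move=> fg [Q hQ cQ]; exists Q => //.
have h1 : \forall x \near (z, z), f x.1 = g x.1 by exact: (cvg_fst_diag fg).
have h2 : \forall x \near (z, z), f x.2 = g x.2 by exact: (cvg_snd_diag fg).
by near=> x; rewrite -(near h1 x)// -(near h2 x)//; near: x.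
Unshelve. all: by end_near. Qed.

Lemma sdif_cst c z : sdif (fun=> c) z 0.
Proof.
exists (fun=> 0); last exact: cvg_cstK.
by near=> x; rewrite mul0r subrr.
Unshelve. all: by end_near. Qed.

Lemma sdif_id z : sdif id z 1.
Proof.
exists (fun=> 1); last exact: cvg_cstK.
by near=> x; rewrite mul1r.
Unshelve. all: by end_near. Qed.

Lemma sdifD f g z d d' : sdif f z d -> sdif g z d' -> sdif (fun x => f x + g x) z (d + d').
Proof.
move=> [Q hQ cQ] [Q' hQ' cQ']; exists (fun x => Q x + Q' x); last exact: (cvgD cQ cQ').
by near=> x; rewrite opprD addrACA (near hQ x)// (near hQ' x)// mulrDl.
Unshelve. all: by end_near. Qed.

Lemma sdifM f g z d d' : sdif f z d -> sdif g z d' ->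
  sdif (fun x => f x * g x) z (d * g z + f z * d').
Proof.
move=> Hf Hg; have cf := sdif_continuous Hf; have cg := sdif_continuous Hg.
case: Hf => Q hQ cQ; case: Hg => Q' hQ' cQ'.
exists (fun x => Q x * g x.1 + f x.2 * Q' x).
  by near=> x; rewrite mulrDl mulrAC -(near hQ x)// -mulrA -(near hQ' x)//; ring.
have c1 : g x.1 @[x --> (z, z)] --> g z := cvg_comp _ _ (@cvg_fst_diag z) cg.
have c2 : f x.2 @[x --> (z, z)] --> f z := cvg_comp _ _ (@cvg_snd_diag z) cf.
exact: (cvgD (cvgM cQ c1) (cvgM c2 cQ')).
Unshelve. all: by end_near. Qed.

Lemma sdifZ c f z d : sdif f z d -> sdif (fun x => c * f x) z (c * d).
Proof. by move=> /(sdifM (sdif_cst c z)); rewrite mul0r add0r. Qed.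

Lemma sdifN f z d : sdif f z d -> sdif (fun x => - f x) z (- d).
Proof.
move=> /(sdifZ (-1)); rewrite mulN1r; apply: sdif_near.
by near=> x; rewrite mulN1r.
Unshelve. all: by end_near. Qed.

Lemma sdifB f g z d d' : sdif f z d -> sdif g z d' -> sdif (fun x => f x - g x) z (d - d').
Proof. by move=> hf /sdifN; exact: sdifD. Qed.

Lemma sdif_near_neq0 f z d : sdif f z d -> f z != 0 -> \forall x \near z, f x != 0.
Proof.
by move=> /sdif_continuous cf fz; exact: (@cvgr_neq0 _ _ _ (nbhs z) _ f (f z)).
Qed.

Lemma sdifV f z d : sdif f z d -> f z != 0 ->
  sdif (fun x => (f x)^-1) z (- d / (f z) ^+ 2).
Proof.
move=> Hf fz; have cf := sdif_continuous Hf; have nf := sdif_near_neq0 Hf fz.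
case: Hf => Q hQ cQ.
exists (fun x => - Q x * ((f x.1)^-1 * (f x.2)^-1)).
  have h1 : \forall x \near (z, z), f x.1 != 0 by exact: (cvg_fst_diag nf).
  have h2 : \forall x \near (z, z), f x.2 != 0 by exact: (cvg_snd_diag nf).
  near=> x.
  have f1 : f x.1 != 0 by near: x.
  have f2 : f x.2 != 0 by near: x.
  have q : f x.1 - f x.2 = Q x * (x.1 - x.2) by near: x.
  rewrite mulrAC mulNr -q; field; exact/andP.
have c1 : f x.1 @[x --> (z, z)] --> f z := cvg_comp _ _ (@cvg_fst_diag z) cf.
have c2 : f x.2 @[x --> (z, z)] --> f z := cvg_comp _ _ (@cvg_snd_diag z) cf.
rewrite expr2 invfM; exact: (cvgM (cvgN cQ) (cvgM (cvgV fz c1) (cvgV fz c2))).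
Unshelve. all: by end_near. Qed.

Lemma sdif_comp f g z d d' : sdif f z d -> sdif g (f z) d' ->
  sdif (fun x => g (f x)) z (d' * d).
Proof.
move=> Hf [Q' hQ' cQ']; have cf := sdif_continuous Hf; case: Hf => Q hQ cQ.
have c2 : (f x.1, f x.2) @[x --> (z, z)] --> (f z, f z).
  exact: (cvg_pair_nbhs (cvg_comp _ _ (@cvg_fst_diag z) cf)
                   (cvg_comp _ _ (@cvg_snd_diag z) cf)).
exists (fun x => Q' (f x.1, f x.2) * Q x).
  have h : \forall x \near (z, z),
      g (f x.1) - g (f x.2) = Q' (f x.1, f x.2) * (f x.1 - f x.2) by exact: (c2 _ hQ').
  by near=> x; rewrite (near h x)// (near hQ x)// mulrA.
have c3 := cvg_comp (fun x : K * K => (f x.1, f x.2)) Q' c2 cQ'.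
exact: (cvgM c3 cQ).
Unshelve. all: by end_near. Qed.

(** The ordinary difference quotient is [Q] along the pairs [(h + z, z)]. *)
Lemma sdif_derivable f z d : sdif f z d ->
  derivable (f : K^o -> K^o) z 1 /\ 'D_1 (f : K^o -> K^o) z = d.
Proof.
case=> Q hQ cQ.
have cz : (h + z, z) @[h --> 0^'] --> (z, z).
  apply: (@cvg_pair_nbhs _ (0 : K)^' _ (fun h => h + z) (fun=> z)); last exact: cvg_cstK.
  have c1 : h + z @[h --> (0 : K)^'] --> z.
    have c : h + z @[h --> (0 : K)^'] --> 0 + z.
      exact: (cvgD (@cvg_within _ (nbhs (0 : K)) _ _) (@cvg_cstK _ ((0 : K)^') _ z)).
    by rewrite add0r in c.
  exact: c1.
have c : h^-1 *: (((f : K^o -> K^o) \o shift z) (h *: (1 : K^o)) - f z) @[h --> 0^'] --> (d : K^o).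
  have cd := cvg_comp _ _ cz cQ.
  apply: cvg_trans cd; apply: near_eq_cvg.
  have q : \forall h \near (0 : K)^', f (h + z) - f z = Q (h + z, z) * (h + z - z).
    exact: (cz _ hQ).
  near=> h.
  have h0 : h != 0 by near: h; exact: nbhs_dnbhs_neq.
  rewrite /comp /=.
  have -> : Q (h + z, z) = h^-1 * (f (h + z) - f z).
    by rewrite (near q h)// addrK mulrCA mulVf// mulr1.
  by rewrite /GRing.scale /= mulr1.
split; first by apply/cvg_ex; exists d.
exact/cvg_lim.
Unshelve. all: by end_near. Qed.

End StrictDerivative.

(** * Strict derivatives over the complex numbers *)

Section ComplexStrictDerivative.
Variable R : realType.
Implicit Types (f g : R[i] -> R[i]) (z d : R[i]).

Lemma nbhs_diagCP z (P : R[i] * R[i] -> Prop) :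
  (\forall x \near ((z, z) : CC R * CC R), P x) <->
  exists2 r : R, 0 < r & forall u v, cmod (u - z) < r -> cmod (v - z) < r -> P (u, v).
Proof.
split=> [[[A B] [/= /nbhsCP [r1 r10 h1] /nbhsCP [r2 r20 h2]] s]|[r r0 h]].
  exists (Num.min r1 r2); first by rewrite lt_min r10.
  move=> u v; rewrite !lt_min => /andP[u1 _] /andP[_ v2].
  by apply: s; split; [exact: h1|exact: h2].
exists ([set u : CC R | cmod (u - z) < r], [set u : CC R | cmod (u - z) < r]).
  by split => /=; apply/nbhsCP; exists r.
by move=> [u v] [/= ? ?]; exact: h.
Qed.

Lemma sdif_eps f z d : sdif f z d -> forall e : R, 0 < e ->
  exists2 r : R, 0 < r & forall u v, cmod (u - z) < r -> cmod (v - z) < r ->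
    cmod (f u - f v - d * (u - v)) <= e * cmod (u - v).
Proof.
move=> [Q /nbhs_diagCP [r1 r10 h1] cQ] e e0.
have /cQ /nbhs_diagCP [r2 r20 h2] : nbhs (d : CC R) [set y : CC R | cmod (y - d) < e].
  by apply/nbhsCP; exists e.
exists (Num.min r1 r2); first by rewrite lt_min r10.
move=> u v; rewrite !lt_min => /andP[u1 u2] /andP[v1 v2].
rewrite (h1 u v)//= -mulrBl cmodM ler_wpM2r ?cmod_ge0//.
by have /= := h2 u v u2 v2; exact: ltW.
Qed.

Lemma eps_sdif f z d : (forall e : R, 0 < e ->
  exists2 r : R, 0 < r & forall u v, cmod (u - z) < r -> cmod (v - z) < r ->
    cmod (f u - f v - d * (u - v)) <= e * cmod (u - v)) -> sdif f z d.
Proof.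
move=> h.
(* On the diagonal the quotient is set to [d], so only pairs off the diagonal need the estimate. *)
exists (fun x => if x.1 == x.2 then d else (f x.1 - f x.2) / (x.1 - x.2)).
  apply/nbhs_diagCP; exists 1 => // u v _ _ /=.
  case: eqVneq => [->|uv]; first by rewrite !subrr mulr0.
  by rewrite divfK// subr_eq0.
move=> A /nbhsCP [e e0 eA].
have [|r r0 hr] := h (e / 2); first lra.
apply/nbhs_diagCP; exists r => // u v ur vr /=; apply: eA.
case: eqVneq => [_|uv]; first by rewrite subrr cmod0.
have uv0 : u - v != 0 by rewrite subr_eq0.
have c0 : 0 < cmod (u - v) by rewrite cmod_gt0.
rewrite -(ltr_pM2r c0) -cmodM mulrBl divfK//.
by apply: le_lt_trans (hr u v ur vr) _; rewrite ltr_pM2r//; lra.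
Qed.

Lemma sdif_continuousCP f z d : sdif f z d -> forall e : R, 0 < e ->
  exists2 r : R, 0 < r & forall y, cmod (y - z) < r -> cmod (f y - f z) < e.
Proof. by move=> /sdif_continuous /(@continuousCP _ f z). Qed.

Lemma exists_small_shift z (r : R) : 0 < r ->
  exists s : R, [/\ 0 < s, cmod ((z + s%:C%C) - z) < r & cmod ((z + s%:C%C) - z) = s].
Proof.
move=> r0; exists (r / 2).
have E : cmod ((z + (r / 2)%:C%C) - z) = r / 2.
  by rewrite addrAC subrr add0r cmodR ger0_norm//; lra.
by split; rewrite ?E//; lra.
Qed.

(** One pair [(z + s, z)] with small [s > 0] suffices: there [f u - f z] differs from [d s] by at
    most [e s], and [e] is arbitrary. *)
Lemma sdif_lipschitz f z d (L r : R) : sdif f z d -> 0 < r ->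
  (forall u v, cmod (u - z) < r -> cmod (v - z) < r ->
     cmod (f u - f v) <= L * cmod (u - v)) -> cmod d <= L.
Proof.
move=> sf r0 hL; apply/ler_addgt0Pl => e e0; rewrite addrC.
have [r1 r10 h1] := sdif_eps sf e0.
have [|s [s0 sr sE]] := @exists_small_shift z (Num.min r r1).
  by rewrite lt_min r0.
move: sr; rewrite lt_min => /andP[sr sr1].
set u := z + _ in sr sr1 sE.
have zz (q : R) : 0 < q -> cmod (z - z) < q by rewrite subrr cmod0.
rewrite -(ler_pM2r s0).
have := h1 u z sr1 (zz _ r10); have := hL u z sr (zz _ r0).
have := cmod_sub_ge (d * (u - z)) (f u - f z).
rewrite (cmodBC (d * _)) [cmod (d * _)]cmodM sE; lra.
Qed.

(** Near [z], [F n - F m] has Lipschitz constant [L n + L m <= 2 L m], so the derivatives of the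
    [F m] form a Cauchy sequence. Its limit is the derivative of [f] by a three-term splitting. *)
Lemma sdif_limit f (F : nat -> R[i] -> R[i]) (L : nat -> R) z (r : R) (k : nat) :
  0 < r ->
  (forall m n, (k <= m)%N -> (m <= n)%N -> L n <= L m) ->
  (forall e : R, 0 < e -> exists2 m, (k <= m)%N & L m < e) ->
  (forall m, (k <= m)%N -> exists d, sdif (F m) z d) ->
  (forall m u v, (k <= m)%N -> cmod (u - z) < r -> cmod (v - z) < r ->
     cmod ((f u - F m u) - (f v - F m v)) <= L m * cmod (u - v)) ->
  exists d, sdif f z d.
Proof.
move=> r0 Ldec L0 sF fF.
have [d hd] : exists d : nat -> R[i], forall m, (k <= m)%N -> sdif (F m) z (d m).
  have /choice [d hd] : forall m, exists y, (k <= m)%N -> sdif (F m) z y.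
    move=> m; have [km|km] := leqP k m; last by exists 0.
    by have [y hy] := sF m km; exists y.
  by exists d.
have [l hl] : exists l, forall m, (k <= m)%N -> cmod (l - d m) <= 2 * L m.
  apply: cauchy_limit => m n km mn; have kn := leq_trans km mn.
  apply: (sdif_lipschitz (sdifB (hd n kn) (hd m km)) r0) => u v ur vr.
  have -> : F n u - F m u - (F n v - F m v) =
    (f u - F m u - (f v - F m v)) - (f u - F n u - (f v - F n v)) by ring.
  apply: le_trans (cmodB _ _) _.
  have := fF m u v km ur vr; have := fF n u v kn ur vr.
  by have := ler_wpM2r (cmod_ge0 (u - v)) (Ldec m n km mn); lra.
exists l; apply: eps_sdif => e e0.
(* The splitting below costs [L m + e / 2 + 2 L m], hence the choice [e / 6]. *)
have [|m km Lm] := L0 (e / 6); first lra.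
have [|r1 r10 h1] := sdif_eps (hd m km) (_ : 0 < e / 2); first lra.
exists (Num.min r r1); first by rewrite lt_min r0.
move=> u v; rewrite !lt_min => /andP[ur ur1] /andP[vr vr1].
have -> : f u - f v - l * (u - v) = (f u - F m u - (f v - F m v)) +
   (F m u - F m v - d m * (u - v)) - (l - d m) * (u - v) by ring.
apply: le_trans (cmodB _ _) _; have := cmodD (f u - F m u - (f v - F m v))
   (F m u - F m v - d m * (u - v)); rewrite [cmod (_ * _)]cmodM.
have := fF m u v km ur vr; have := h1 u v ur1 vr1.
have := ler_wpM2r (cmod_ge0 (u - v)) (hl m km).
have := ler_wpM2r (cmod_ge0 (u - v)) (ltW Lm); lra.
Qed.

(** * Quantitative local inversion *)

Section LocalInverse.
Variables (g : R[i] -> R[i]) (d : R[i]) (r : R).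
Hypothesis (d0 : d != 0) (r0 : 0 < r).
Hypothesis hg : forall u v, cmod u < r -> cmod v < r ->
  cmod (g u - g v - d * (u - v)) <= cmod d / 2 * cmod (u - v).

Lemma local_inverse_lower u v : cmod u < r -> cmod v < r ->
  cmod d / 2 * cmod (u - v) <= cmod (g u - g v).
Proof.
move=> ur vr; have := hg ur vr.
have := cmod_sub_ge (d * (u - v)) (g u - g v); rewrite (cmodBC (d * _)) [cmod (d * _)]cmodM; lra.
Qed.

Lemma local_inverse_inj u v : cmod u < r -> cmod v < r -> g u = g v -> u = v.
Proof.
move=> ur vr guv; have := local_inverse_lower ur vr; rewrite guv subrr cmod0.
have c0 : 0 < cmod d / 2 by rewrite divr_gt0// cmod_gt0.
rewrite pmulr_rle0// => h; apply/eqP; rewrite -subr_eq0 -cmod_eq0.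
by rewrite eq_le h cmod_ge0.
Qed.

(** The minimum of [cmod (g t - b)] over the closed disc of radius [r / 2] is zero: otherwise a
    damped Newton step with the fixed slope [d] would lower it. *)
Lemma local_inverse_surj b : g 0 = 0 -> cmod b < cmod d * r / 8 ->
  exists2 t, cmod t < r & g t = b.
Proof.
move=> g0 hb; have rp := r0; have dp : 0 < cmod d by rewrite cmod_gt0.
pose A := [set t : CC R | cmod t <= r / 2].
have A0 : A !=set0.
  by exists (0 : R[i]); suff: cmod (0 : R[i]) <= r / 2 by []; rewrite cmod0; lra.
have cphi : {within A, continuous (fun t : CC R => cmod (g t - b))}.
  apply: continuous_in_subspaceT => t; rewrite inE /A /= => tr.
  apply: (@continuous_comp _ _ _ (fun t : CC R => g t - b : CC R)); last first.
    exact: continuous_cmod.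
  apply/continuousCP => e e0.
  exists (Num.min (r / 2) (e / (2 * cmod d))).
    by rewrite lt_min !divr_gt0// mulr_gt0.
  move=> y; rewrite lt_min => /andP[yr]; rewrite ltr_pdivlMr ?mulr_gt0// => ye.
  have -> : g y - b - (g t - b) = (g y - g t - d * (y - t)) + d * (y - t) by ring.
  have yr' : cmod y < r by have := cmod_sub_ge y t; lra.
  have tr' : cmod t < r by lra.
  have := hg yr' tr'; have := cmodD (g y - g t - d * (y - t)) (d * (y - t)).
  rewrite [cmod (d * _)]cmodM; have := cmod_ge0 (y - t); nra.
have [t] := compact_EVT_min A0 (@compact_cdisc R (r / 2)) cphi.
rewrite inE /A /= => tr hmin.
have tr' : cmod t < r by lra.
have z0 : cmod (0 : R[i]) < r by rewrite cmod0.
(* On the circle of radius [r / 2], [cmod (g t)] is at least [cmod d * r / 4 > 2 * cmod b], so the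
   centre would give a smaller value than [t]. *)
have tr2 : cmod t < r / 2.
  rewrite ltNge; apply/negP => rt; have := local_inverse_lower tr' z0.
  rewrite g0 !subr0 => h1; have := hmin (0 : R[i]); rewrite inE /A /= cmod0 g0 sub0r cmodN.
  have := cmod_sub_ge (g t) b; nra.
exists t => //; apply/eqP; rewrite -subr_eq0 -cmod_eq0 eq_le cmod_ge0 andbT leNgt.
apply/negP => m0; set m := cmod _ in m0.
(* The bound [1 / 2] keeps [1 - s] positive, the other one keeps [t1] in the closed disc. The new
   value is at most [(1 - s) m + s m / 2 < m]. *)
pose s := Num.min (1 / 2) ((r / 2 - cmod t) * cmod d / (2 * m)).
have s0 : 0 < s.
  rewrite lt_min divr_gt0//=; apply: divr_gt0; last by apply: mulr_gt0.
  by apply: mulr_gt0 => //; lra.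
have s1 : s <= 1 / 2 by rewrite /s ge_min lexx.
have s2 : s * m / cmod d <= (r / 2 - cmod t) / 2.
  have : s <= (r / 2 - cmod t) * cmod d / (2 * m) by rewrite /s ge_min lexx orbT.
  rewrite ler_pdivlMr ?mulr_gt0// => h; rewrite ler_pdivrMr//; lra.
pose t1 : R[i] := t - s%:C%C * (g t - b) / d.
have E : cmod (t1 - t) = s * m / cmod d.
  rewrite /t1 addrAC subrr sub0r cmodN !cmodM cmodV cmodR ger0_norm//; exact: ltW.
have t1r : cmod t1 <= r / 2 by have := cmod_sub_ge t1 t; lra.
have t1r' : cmod t1 < r by lra.
have := hmin t1; rewrite inE /A /= => /(_ t1r).
have : g t1 - b = (g t1 - g t - d * (t1 - t)) + (1 - s)%:C%C * (g t - b).
  by rewrite /t1 rmorphB rmorph1; field.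
move=> ->; apply/negP; rewrite -ltNge; apply: le_lt_trans (cmodD _ _) _.
have := hg t1r' tr'; rewrite E cmodM cmodR ger0_norm -/m; last lra.
have -> : cmod d / 2 * (s * m / cmod d) = s * m / 2 by field; rewrite cmod_eq0.
nra.
Qed.

End LocalInverse.

Lemma sdif_local_inverse g d : sdif g 0 d -> d != 0 ->
  \forall r \near 0^'+, forall u v, cmod u < r -> cmod v < r ->
  cmod (g u - g v - d * (u - v)) <= cmod d / 2 * cmod (u - v).
Proof.
move=> sg d0; have [|r r0 h] := sdif_eps sg (_ : 0 < cmod d / 2).
  by rewrite divr_gt0// cmod_gt0.
apply/near0rP; exists r => // s /andP[s0 sr] u v us vs.
by apply: h; rewrite subr0; lra.
Qed.

(** * Estimates uniform over a compact set *)

Lemma compact_pairs (K : set (CC R)) (Q : R -> R[i] -> R[i] -> Prop) :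
  compact K ->
  (forall z w, K z -> K w -> exists2 r : R, 0 < r & exists2 e0 : R, 0 < e0 &
     forall u v e, cmod (u - z) < r -> cmod (v - w) < r -> 0 < e < e0 -> Q e u v) ->
  \forall e \near 0^'+, forall u v, K u -> K v -> Q e u v.
Proof.
move=> cK h.
have cKK := compact_setX cK cK.
(* Compactness of the product as a covering property: validity near every pair for all small [e],
   diagonal pairs included, becomes validity for all pairs at once. *)
have /compact_near_coveringP/(_ _ (0 : R)^'+ (fun e x => Q e x.1 x.2) _) := cKK.
have H : forall x : CC R * CC R, (K `*` K) x ->
    \forall x' \near x & e \near 0^'+, Q e x'.1 x'.2.
  move=> [z w] [/= Kz Kw]; have [r r0 [e0 e00 hQ]] := h z w Kz Kw.
  exists ([set x' : CC R * CC R | cmod (x'.1 - z) < r /\ cmod (x'.2 - w) < r],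
    [set e : R | 0 < e < e0]).
    split => /=.
      exists ([set u : CC R | cmod (u - z) < r], [set u : CC R | cmod (u - w) < r]).
        by split => /=; apply/nbhsCP; exists r.
      by move=> [u v] [].
    by apply/near0rP; exists e0.
  by move=> [[u v] e] [/= [h1 h2] h3]; exact: hQ.
move=> /(_ H); apply: filterS => e he u v Ku Kv.
by have := he (u, v); apply.
Qed.

(** A small factor [e] plays the role of an inverse Lipschitz constant. Near a diagonal pair the
    strict derivative gives the bound; near any other pair [cmod (u - v)] stays away from zero while
    [h] is bounded. *)
Lemma compact_lipschitz (K : set (CC R)) h : compact K ->
  (forall z, K z -> exists d, sdif h z d) ->
  \forall e \near 0^'+, forall u v, K u -> K v ->
    e * cmod (h u - h v) <= cmod (u - v).
Proof.
move=> cK sh; apply: (@compact_pairs K) => // z w Kz Kw.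
have [d sd] := sh z Kz; have [d' sd'] := sh w Kw.
have [<-|zw] := eqVneq z w.
  have [//|r r0 hr] := sdif_eps sd (_ : 0 < 1).
  have d1 : 0 < cmod d + 1 by rewrite ltr_wpDl// cmod_ge0.
  exists r => //; exists (cmod d + 1)^-1; first by rewrite invr_gt0.
  move=> u v e ur vr /andP[e0]; rewrite -[_^-1]mul1r ltr_pdivlMr// => e1.
  have := hr u v ur vr; rewrite mul1r.
  have := cmod_sub_ge (h u - h v) (d * (u - v)); rewrite [cmod (d * _)]cmodM.
  have := cmod_ge0 (u - v); have := cmod_ge0 (h u - h v); nra.
have c0 : 0 < cmod (z - w) by rewrite cmod_gt0 subr_eq0.
have [//|r1 r10 h1] := sdif_continuousCP sd (_ : 0 < 1).
have [//|r2 r20 h2] := sdif_continuousCP sd' (_ : 0 < 1).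
have M0 : 0 < cmod (h z - h w) + 2 by rewrite ltr_wpDl// cmod_ge0.
exists (Num.min (Num.min r1 r2) (cmod (z - w) / 4)).
  by rewrite !lt_min r10 r20 divr_gt0.
exists (cmod (z - w) / 2 / (cmod (h z - h w) + 2)); first by rewrite !divr_gt0.
move=> u v e; rewrite !lt_min => /andP[/andP[u1 _] u3] /andP[/andP[_ v2] v3].
rewrite ltr_pdivlMr// => /andP[e0 e1].
have a1 := h1 u u1; have a2 := h2 v v2.
have a3 : cmod (h u - h v) <= cmod (h z - h w) + 2.
  have := cmodBD (h u) (h z) (h v); have := cmodBD (h z) (h w) (h v).
  by rewrite (cmodBC (h w)); lra.
have a4 : cmod (z - w) / 2 <= cmod (u - v).
  have := cmodBD z u w; have := cmodBD u v w; rewrite (cmodBC z u); lra.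
nra.
Qed.

Lemma compact_bound (K : set (CC R)) h : compact K ->
  (forall z, K z -> exists d, sdif h z d) ->
  \forall e \near 0^'+, forall u, K u -> e * cmod (h u) <= 1.
Proof.
move=> cK sh.
suff : \forall e \near 0^'+, forall u v, K u -> K v -> e * cmod (h u) <= 1.
  by apply: filterS => e he u Ku; exact: (he u u).
apply: (@compact_pairs K) => // z w Kz Kw; have [d sd] := sh z Kz.
have [//|r1 r10 h1] := sdif_continuousCP sd (_ : 0 < 1).
have M0 : 0 < cmod (h z) + 1 by rewrite ltr_wpDl// cmod_ge0.
exists r1 => //; exists (cmod (h z) + 1)^-1; first by rewrite invr_gt0.
move=> u v e ur _ /andP[e0]; rewrite -[_^-1]mul1r ltr_pdivlMr// => e1.
by have := h1 u ur; have := cmod_sub_ge (h u) (h z); nra.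
Qed.

(** Immersivity gives the bound near diagonal pairs, injectivity near the others. *)
Lemma compact_lower_lipschitz (K : set (CC R)) (X Y : R[i] -> R[i]) : compact K ->
  (forall z, K z -> exists dx dy, [/\ sdif X z dx, sdif Y z dy & (dx != 0) || (dy != 0)]) ->
  (forall z w, K z -> K w -> X z = X w -> Y z = Y w -> z = w) ->
  \forall e \near 0^'+, forall u v, K u -> K v ->
    e * cmod (u - v) <= cmod (X u - X v) + cmod (Y u - Y v).
Proof.
move=> cK sXY inj; apply: (@compact_pairs K) => // z w Kz Kw.
have [dx [dy [sx sy dxy]]] := sXY z Kz.
have [dx' [dy' [sx' sy' _]]] := sXY w Kw.
have [<-|zw] := eqVneq z w.
  have main (f : R[i] -> R[i]) (d : R[i]) : sdif f z d -> d != 0 ->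
      exists2 r : R, 0 < r & exists2 e0 : R, 0 < e0 & forall u v e,
      cmod (u - z) < r -> cmod (v - z) < r -> 0 < e < e0 ->
      e * cmod (u - v) <= cmod (f u - f v).
    move=> sf d0; have d1 : 0 < cmod d / 2 by rewrite divr_gt0// cmod_gt0.
    have [r r0 hr] := sdif_eps sf d1.
    exists r => //; exists (cmod d / 2) => // u v e ur vr /andP[e0 e1].
    have := hr u v ur vr; have := cmod_sub_ge (d * (u - v)) (f u - f v).
    rewrite (cmodBC (d * _)) [cmod (d * _)]cmodM.
    by have := ler_wpM2r (cmod_ge0 (u - v)) (ltW e1); lra.
  case/orP: dxy => d0.
    have [r r0 [e0 e00 h]] := main X dx sx d0.
    exists r => //; exists e0 => // u v e ur vr ee; have := h u v e ur vr ee.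
    by have := cmod_ge0 (Y u - Y v); lra.
  have [r r0 [e0 e00 h]] := main Y dy sy d0.
  exists r => //; exists e0 => // u v e ur vr ee; have := h u v e ur vr ee.
  by have := cmod_ge0 (X u - X v); lra.
pose m := cmod (X z - X w) + cmod (Y z - Y w).
have m0 : 0 < m.
  rewrite lt_def addr_ge0 ?cmod_ge0// andbT paddr_eq0 ?cmod_ge0//.
  rewrite !cmod_eq0 !subr_eq0; apply/negP => /andP[/eqP e1 /eqP e2].
  by move/eqP: zw; apply; exact: inj.
(* Each of the four values moves by less than [m / 8], so at least [m / 2] of the separation [m]
   remains. *)
have m8 : 0 < m / 8 by lra.
have [r1 r10 h1] := sdif_continuousCP sx m8.
have [r2 r20 h2] := sdif_continuousCP sx' m8.
have [r3 r30 h3] := sdif_continuousCP sy m8.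
have [r4 r40 h4] := sdif_continuousCP sy' m8.
have M0 : 0 < cmod (z - w) + 2 by rewrite ltr_wpDl// cmod_ge0.
exists (Num.min (Num.min (Num.min r1 r2) (Num.min r3 r4)) 1).
  by rewrite !lt_min r10 r20 r30 r40 ltr01.
exists (m / 2 / (cmod (z - w) + 2)); first by rewrite !divr_gt0.
move=> u v e; rewrite !lt_min.
move=> /andP[/andP[/andP[u1 _] /andP[u3 _]] u5] /andP[/andP[/andP[_ v2] /andP[_ v4]] v5].
rewrite ltr_pdivlMr// => /andP[e0 e1].
have a1 := h1 u u1; have a2 := h2 v v2; have a3 := h3 u u3; have a4 := h4 v v4.
have b1 : cmod (X z - X w) <= cmod (X u - X v) + m / 4.
  have := cmodBD (X z) (X u) (X w); have := cmodBD (X u) (X v) (X w).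
  by rewrite (cmodBC (X z) (X u)); lra.
have b2 : cmod (Y z - Y w) <= cmod (Y u - Y v) + m / 4.
  have := cmodBD (Y z) (Y u) (Y w); have := cmodBD (Y u) (Y v) (Y w).
  by rewrite (cmodBC (Y z) (Y u)); lra.
have b3 : cmod (u - v) <= cmod (z - w) + 2.
  have := cmodBD u z v; have := cmodBD z w v; rewrite (cmodBC w v); lra.
have : m / 2 <= cmod (X u - X v) + cmod (Y u - Y v) by rewrite /m; rewrite /m in b1 b2; lra.
nra.
Qed.

End ComplexStrictDerivative.

(** * Discs on the Riemann sphere *)

Section SphereDiscs.
Variable R : realType.
Implicit Types (x y p q : sphere R) (z w a : R[i]) (r e : R).

(** Discs in the local coordinate [z - a] or [1 / z]. At infinity the condition [cmod (1 / z) < r]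
    is multiplied out, because the convention [0^-1 = 0] would put 0 into the disc. *)
Definition disc p r : set (sphere R) := fun x =>
  match p, x with
  | Some a, Some z => cmod (z - a) < r
  | Some _, None => False
  | None, None => True
  | None, Some z => 1 < r * cmod z
  end.

Definition cdisc p r : set (sphere R) := fun x =>
  match p, x with
  | Some a, Some z => cmod (z - a) <= r
  | Some _, None => False
  | None, None => True
  | None, Some z => 1 <= r * cmod z
  end.

Lemma disc_center p r : 0 < r -> disc p r p.
Proof. by case: p => //= a r0; rewrite subrr cmod0. Qed.

Lemma disc_sub_cdisc p r : disc p r `<=` cdisc p r.
Proof. by case: p => [a|] [z|] //= /ltW. Qed.

Lemma disc_shrink p r x : 0 < r -> disc p r x ->
  \forall e \near 0^'+, cdisc x e `<=` disc p r.
Proof.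
move=> r0; case: p x => [a|] [z|] //= h; apply/near0rP.
- exists (r - cmod (z - a)); first by rewrite subr_gt0.
  by move=> e /andP[e0 er] [w|] //= hw; have := cmodBD w z a; lra.
- exists (cmod z - r^-1).
    by rewrite subr_gt0 -[_^-1]mul1r ltr_pdivrMr// mulrC.
  move=> e /andP[e0 er] [w|] //= hw; rewrite -ltr_pdivrMl// mulr1.
  by have := cmod_sub_ge z w; rewrite cmodBC; lra.
- exists r => // e /andP[e0 er] [w|] //= hw; apply: (le_lt_trans hw).
  rewrite ltr_pM2r// cmod_gt0; apply/eqP => w0; move: hw.
  by rewrite w0 cmod0 mulr0 ler10.
Qed.

Lemma disc_disjoint p q : p != q ->
  \forall e \near 0^'+, forall x, disc p e x -> disc q e x -> False.
Proof.
have main b : \forall e \near 0^'+, forall x, disc None e x -> disc (Some b) e x -> False.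
  have b1 : 0 < cmod b + 1 by rewrite ltr_wpDl// cmod_ge0.
  apply/near0rP; exists (Num.min 1 (cmod b + 1)^-1); first by rewrite lt_min ltr01 invr_gt0.
  move=> e /andP[e0]; rewrite lt_min -[_^-1]mul1r ltr_pdivlMr// => /andP[e1 eb].
  move=> [w|] //= h1 h2; have := cmod_sub_ge w b.
  by have := cmod_ge0 w; have := cmod_ge0 b; nra.
case: p q => [a|] [b|] ab; last by rewrite eqxx in ab.
- have c0 : 0 < cmod (a - b).
    by rewrite cmod_gt0 subr_eq0; apply: contra_neq ab => ->.
  apply/near0rP; exists (cmod (a - b) / 2); first by rewrite divr_gt0.
  move=> e /andP[e0 e1] [w|] //= h1 h2; have := cmodBD a w b.
  by rewrite (cmodBC a w); lra.
- by have := main a; apply: filterS => e h x h1 h2; exact: (h x).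
- exact: main.
Qed.

Lemma cdisc_sep p r x : 0 < r -> ~ cdisc p r x ->
  \forall e \near 0^'+, forall y, disc x e y -> ~ cdisc p r y.
Proof.
move=> r0; case: p x => [a|] [z|] //=.
- move=> /negP; rewrite -ltNge => h; apply/near0rP.
  exists (cmod (z - a) - r); first by rewrite subr_gt0.
  move=> e /andP[e0 e1] [w|] //= h1 h2; have := cmodBD z w a.
  by rewrite (cmodBC z w); lra.
- move=> _; have c0 : 0 < cmod a + r by rewrite ltr_wpDl// cmod_ge0.
  apply/near0rP; exists (cmod a + r)^-1; first by rewrite invr_gt0.
  move=> e /andP[e0]; rewrite -[_^-1]mul1r ltr_pdivlMr// => e1 [w|] /= h1 h2; last by [].
  by have := cmod_sub_ge w a; have := cmod_ge0 w; nra.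
- move=> /negP; rewrite -ltNge => h; apply/near0rP.
  exists (r^-1 - cmod z).
    by rewrite subr_gt0 -[_^-1]mul1r ltr_pdivlMr// mulrC.
  move=> e /andP[e0 e1] [w|] //= h1; apply/negP; rewrite -ltNge mulrC.
  by rewrite -ltr_pdivlMr// mul1r; have := cmod_sub_ge w z; lra.
Qed.

(** Half the squared Euclidean chord, equal to one minus the cosine of [sdist]. It is rational in
    the coordinates, so estimates are made here and transferred to [sdist] afterwards. *)
Definition chd x y : R := 1 - dot3 (stereo x) (stereo y).

Lemma cmod_sqr z : cmod z ^+ 2 = complex.Re z ^+ 2 + complex.Im z ^+ 2.
Proof.
by case: z => a b; rewrite /cmod /= sqr_sqrtr// addr_ge0// sqr_ge0.
Qed.

Lemma one_sqr_gt0 (t : R) : 0 < 1 + t ^+ 2.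
Proof. by rewrite ltr_pwDl// sqr_ge0. Qed.

Lemma chdSS z w : chd (Some z) (Some w) =
  2 * cmod (z - w) ^+ 2 / ((1 + cmod z ^+ 2) * (1 + cmod w ^+ 2)).
Proof.
have := one_sqr_gt0 (cmod z); have := one_sqr_gt0 (cmod w).
rewrite /chd /dot3 /stereo /= !cmod_sqr.
case: z => a b; case: w => c d /= h1 h2.
field; rewrite ?gt_eqF//; lra.
Qed.

Lemma chdNS z : chd None (Some z) = 2 / (1 + cmod z ^+ 2).
Proof.
have := one_sqr_gt0 (cmod z).
rewrite /chd /dot3 /stereo /= !cmod_sqr; case: z => a b /= h1.
field; rewrite ?gt_eqF//; lra.
Qed.

Lemma chdC x y : chd x y = chd y x.
Proof. by rewrite /chd /dot3; congr (1 - _); ring. Qed.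

Lemma stereo_unit x : dot3 (stereo x) (stereo x) = 1.
Proof.
case: x => [[a b]|]; rewrite /dot3 /stereo /=; last by ring.
have : 0 < 1 + (a ^+ 2 + b ^+ 2) by rewrite ltr_pwDl// addr_ge0// sqr_ge0.
move=> h; field; rewrite ?gt_eqF//; lra.
Qed.

Lemma chdxx x : chd x x = 0.
Proof. by rewrite /chd stereo_unit subrr. Qed.

Lemma chd_ge0 x y : 0 <= chd x y.
Proof.
have := stereo_unit x; have := stereo_unit y; rewrite /chd.
case: (stereo x) => -[a b] c; case: (stereo y) => -[a' b'] c'; rewrite /dot3 /= => h h'.
have := sqr_ge0 (a - a'); have := sqr_ge0 (b - b'); have := sqr_ge0 (c - c'); lra.
Qed.

Lemma chd_le2 x y : chd x y <= 2.
Proof.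
have := stereo_unit x; have := stereo_unit y; rewrite /chd.
case: (stereo x) => -[a b] c; case: (stereo y) => -[a' b'] c'; rewrite /dot3 /= => h h'.
have := sqr_ge0 (a + a'); have := sqr_ge0 (b + b'); have := sqr_ge0 (c + c'); lra.
Qed.

(** The parallelogram law: the defect is half the squared length of [x + y - 2 p]. This stands in
    for the triangle inequality of [sdist]. *)
Lemma chd_quasi_triangle x y p : chd x y <= 2 * (chd p x + chd p y).
Proof.
have := stereo_unit x; have := stereo_unit y; have := stereo_unit p; rewrite /chd.
case: (stereo x) => -[a b] c; case: (stereo y) => -[a' b'] c'.
case: (stereo p) => -[u v] w; rewrite /dot3 /= => h h' h''.
have := sqr_ge0 (a + a' - 2 * u); have := sqr_ge0 (b + b' - 2 * v).
have := sqr_ge0 (c + c' - 2 * w); lra.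
Qed.

Lemma dot3_itv x y : -1 <= dot3 (stereo x) (stereo y) <= 1.
Proof.
by have := chd_ge0 x y; have := chd_le2 x y; rewrite /chd => *; apply/andP; split; lra.
Qed.

Lemma sdist_ge0 x y : 0 <= sdist x y.
Proof. exact/acos_ge0/dot3_itv. Qed.

Lemma sdist_lepi x y : sdist x y <= pi.
Proof. exact/acos_lepi/dot3_itv. Qed.

Lemma cos_sdist x y : cos (sdist x y) = 1 - chd x y.
Proof.
have [_ h] := acos_def (dot3_itv x y); rewrite /sdist h /chd; ring.
Qed.

Lemma sdist_small e : 0 < e ->
  exists2 d : R, 0 < d & forall x y, chd x y < d -> sdist x y < e.
Proof.
(* The threshold is capped at [pi] because the comparison uses that cosine decreases on
   [[0, pi]]. *)
move=> e0; pose e' := Num.min e pi.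
have e'0 : 0 < e' by rewrite lt_min e0 pi_gt0.
have e'pi : e' <= pi by rewrite ge_min lexx orbT.
have e'e : e' <= e by rewrite ge_min lexx.
have i0 : (0 : R) \in `[0, pi] by rewrite in_itv /= lexx pi_ge0.
have i1 : e' \in `[0, pi] by rewrite in_itv /= (ltW e'0).
exists (1 - cos e'); first by rewrite subr_gt0 -cos0 ltr_cos.
move=> x y xy; apply: lt_le_trans e'e.
have i2 : sdist x y \in `[0, pi] by rewrite in_itv /= sdist_ge0 sdist_lepi.
by rewrite -ltr_cos// cos_sdist; lra.
Qed.

Lemma chd_small e : 0 < e ->
  exists2 d : R, 0 < d & forall x y, sdist x y < d -> chd x y < e.
Proof.
move=> e0.
have : nbhs (cos (0 : R)) [set t | 1 - e < t].
  by rewrite cos0; apply: lt_nbhsr; lra.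
move=> /(@continuous_cos R 0) [d /= d0 h]; exists d => // x y xy.
have /h : ball_ [eta Num.Def.normr] 0 d (sdist x y).
  by rewrite /ball_ /= sub0r normrN ger0_norm// sdist_ge0.
by rewrite /= cos_sdist; lra.
Qed.

Lemma chd_disc_center p x r : 0 < r -> disc p r x -> chd p x <= 2 * r ^+ 2.
Proof.
move=> r0; case: p x => [a|] [z|] //=.
- move=> h; rewrite chdSS ler_pdivrMr ?mulr_gt0 ?one_sqr_gt0//.
  have h1 : cmod (a - z) ^+ 2 <= r ^+ 2.
    by rewrite ler_pXn2r// ?nnegrE ?cmod_ge0 ?(ltW r0)// cmodBC ltW.
  have := sqr_ge0 (cmod a); have := sqr_ge0 (cmod z); have := sqr_ge0 r.
  move: (cmod a ^+ 2) (cmod z ^+ 2) (r ^+ 2) (cmod (a - z) ^+ 2) h1 => A Z S T h1 S0 Z0 A0.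
  have : 0 <= S * (A + Z + A * Z) by rewrite mulr_ge0// !addr_ge0// mulr_ge0.
  by lra.
- move=> h; rewrite chdNS ler_pdivrMr ?one_sqr_gt0//.
  have h1 : 1 <= (r * cmod z) ^+ 2 by rewrite exprn_ege1// ltW.
  rewrite exprMn in h1; have := sqr_ge0 r; lra.
- by move=> _; rewrite chdxx mulr_ge0// sqr_ge0.
Qed.

Lemma chd_disc p x y r : 0 < r -> disc p r x -> disc p r y -> chd x y <= 8 * r ^+ 2.
Proof.
move=> r0 /(chd_disc_center r0) h1 /(chd_disc_center r0) h2.
by have := chd_quasi_triangle x y p; lra.
Qed.

Lemma disc_sdist_small e : 0 < e ->
  \forall r \near 0^'+, forall p x y, disc p r x -> disc p r y -> sdist x y < e.
Proof.
move=> e0; have [d d0 hd] := sdist_small e0.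
apply/near0rP; exists (Num.min 1 (d / 8)); first by rewrite lt_min ltr01 divr_gt0.
move=> r /andP[r0]; rewrite lt_min => /andP[r1 rd] p x y hx hy; apply: hd.
by apply: le_lt_trans (chd_disc r0 hx hy) _; rewrite expr2; nra.
Qed.

Lemma chd_small_disc p r : 0 < r ->
  exists2 d : R, 0 < d & forall x, chd p x < d -> disc p r x.
Proof.
move=> r0; case: p => [a|].
  set A := cmod a ^+ 2; have A0 : 0 <= A := sqr_ge0 _.
  have D0 : 0 < (1 + A) * (1 + 2 * A + 2 * r ^+ 2).
    have := sqr_ge0 r => ?; apply: mulr_gt0; lra.
  (* With [T = cmod (a - z) ^+ 2], the chordal quantity is at least
     [2 T / ((1 + A) (1 + 2 A + 2 T))], which increases with [T]; the threshold is its value at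
     [T = r ^+ 2]. *)
  exists (2 * r ^+ 2 / ((1 + A) * (1 + 2 * A + 2 * r ^+ 2))).
    by rewrite divr_gt0// mulr_gt0// exprn_gt0.
  move=> [z|].
    rewrite chdSS -/A => h /=; rewrite ltNge; apply/negP => rz; move: h.
    apply/negP; rewrite -leNgt.
    rewrite ler_pdivrMr// mulrAC ler_pdivlMr ?mulr_gt0 ?one_sqr_gt0// -/A.
    have h1 : r ^+ 2 <= cmod (a - z) ^+ 2.
      by rewrite ler_pXn2r// ?nnegrE ?cmod_ge0 ?(ltW r0)// cmodBC.
    have h2 : cmod z ^+ 2 <= 2 * A + 2 * cmod (a - z) ^+ 2.
      have h3 : cmod z <= cmod a + cmod (a - z).
        by have := cmod_sub_ge z a; rewrite (cmodBC z); lra.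
      have h4 : cmod z ^+ 2 <= (cmod a + cmod (a - z)) ^+ 2.
        by rewrite ler_pXn2r// ?nnegrE ?addr_ge0 ?cmod_ge0.
      by have := sqr_ge0 (cmod a - cmod (a - z)); rewrite /A; lra.
    move: (sqr_ge0 r) h1 h2; move: (cmod z ^+ 2) (r ^+ 2) (cmod (a - z) ^+ 2) => Z S T S0 h1 h2.
    rewrite ![_ * ((1 + A) * _)]mulrCA ler_pM2l; last lra.
    have := ler_wpM2l S0 h2; have A1 : 0 <= 1 + 2 * A by lra.
    by have := ler_wpM2r A1 h1; lra.
  rewrite chdC chdNS -/A => h; exfalso; move: h; apply/negP; rewrite -leNgt.
  rewrite ler_pdivrMr// mulrAC ler_pdivlMr; last lra.
  by have := sqr_ge0 r; nra.
have D0 : 0 < 1 + r^-1 ^+ 2 := one_sqr_gt0 _.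
exists (2 / (1 + r^-1 ^+ 2)); first by rewrite divr_gt0.
move=> [z|//]; rewrite chdNS => h /=; rewrite mulrC -ltr_pdivrMr// mul1r ltNge.
apply/negP => rz; move: h; apply/negP; rewrite -leNgt ler_pM2l// lef_pV2 ?posrE ?one_sqr_gt0//.
by rewrite lerD2l ler_pXn2r// ?nnegrE ?cmod_ge0 ?invr_ge0 ?(ltW r0).
Qed.

Lemma disc_open p r : 0 < r -> open (disc p r).
Proof.
move=> r0; suff: sopen (disc p r) by [].
move=> x px; have /near0rP [e0 e00 he] := disc_shrink r0 px.
have e20 : 0 < e0 / 2 by lra.
have [d d0 hd] := chd_small_disc x e20.
have [d' d'0 hd'] := chd_small d0.
exists d' => // y xy; apply: (he (e0 / 2)); first lra.
by apply: disc_sub_cdisc; apply: hd; exact: hd'.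
Qed.

(** Spherical balls and coordinate discs generate the same neighbourhoods, so the topology can be
    handled in coordinates. *)
Lemma nbhs_sphereP x (A : set (sphere R)) :
  nbhs x A <-> exists2 r, 0 < r & disc x r `<=` A.
Proof.
split=> [|[r r0 h]]; last first.
  rewrite nbhsE /=; exists (disc x r) => //; split; first exact: disc_open.
  exact: disc_center.
rewrite nbhsE /= => -[B [oB Bx] BA].
have oB' : sopen B by [].
have [e e0 he] := oB' x Bx.
have /near0rP [r r0 hr] := disc_sdist_small e0.
exists (r / 2); first lra.
move=> y xy; apply/BA/he; apply: (hr (r / 2) _ x) => //; first lra.
by apply: disc_center; lra.
Qed.

Lemma near0_nbhs_sphere x (A : set (sphere R)) :
  (\forall r \near 0^'+, disc x r `<=` A) -> nbhs x A.
Proof.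
move=> /near0rP [r r0 h]; apply/nbhs_sphereP; exists (r / 2); first lra.
by apply: h; lra.
Qed.

Lemma cdisc_closed p r : 0 < r -> closed (cdisc p r).
Proof.
move=> r0 x cx; apply: contrapT => /(cdisc_sep r0) h.
have /cx [y [/= h1 h2]] : nbhs x (~` cdisc p r).
  by apply: near0_nbhs_sphere; apply: filterS h => e h y; exact: h.
exact: h2.
Qed.

Lemma continuous_Some : continuous (fun z : CC R => Some z : sphere R).
Proof.
move=> z A /nbhs_sphereP [r r0 h]; apply/nbhsCP; exists r => // y yz.
exact: h.
Qed.

(** A filter that does not cluster at infinity contains a set missing a disc about infinity, hence
    lives on a compact disc of the plane. *)
Lemma sphere_compact : compact [set: sphere R].
Proof.
move=> F FF _.
have [cN|] := pselect (cluster F None); first by exists None.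
move=> ncN.
have [A [B [FA nB AB]]] : exists A B, [/\ F A, nbhs (None : sphere R) B & A `&` B = set0].
  apply: contrapT => h; apply: ncN => A B FA nB; apply: contrapT => /set0P/negP.
  by rewrite negbK => /eqP AB; apply: h; exists A, B.
have /nbhs_sphereP [r r0 rB] := nB.
pose D := [set z : CC R | cmod z <= r^-1].
have cD : compact ((fun z : CC R => Some z : sphere R) @` D).
  apply: continuous_compact; last exact: compact_cdisc.
  by apply: continuous_subspaceT; exact: continuous_Some.
have FD : F ((fun z : CC R => Some z : sphere R) @` D).
  apply: filterS FA => x Ax.
  have nBx : ~ disc None r x.
    by move=> /rB Bx; have : (A `&` B) x by []; rewrite AB.
  case: x Ax nBx => [z _|_ []]// /negP; rewrite -leNgt => h; exists z => //.
  by rewrite /D /= -[_^-1]mul1r ler_pdivlMr// mulrC.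
by have [x [_ cx]] := cD F FF FD; exists x.
Qed.

(** Distinct points have disjoint small discs, while closeness in [sdist] would put [y] into the
    disc about [x]. *)
Lemma sdist_eq0_sep x y : (forall e : R, 0 < e -> sdist x y < e) -> x = y.
Proof.
move=> h; apply/eqP/negPn/negP => xy.
have /near0rP [r r0 hr] := disc_disjoint xy.
have r20 : 0 < r / 2 by lra.
have [d d0 hd] := chd_small_disc x r20.
have [e e0 he] := chd_small d0.
apply: (hr (r / 2) _ y); [lra|exact/hd/he/h|exact: disc_center].
Qed.

End SphereDiscs.

(** * Simple poles and stages of the construction *)

Section Poles.
Variable R : realType.
Implicit Types (f g u v F : R[i] -> R[i]) (z d a c t : R[i]).

(** If both derivatives vanished, [X] and [Y] would be [c / 4]-Lipschitz near [z], which contradicts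
    the lower bound with constant [c]. *)
Lemma sdif_pair_lower (X Y : R[i] -> R[i]) z (dx dy : R[i]) (c r : R) :
  sdif X z dx -> sdif Y z dy -> 0 < c -> 0 < r ->
  (forall u v : R[i], cmod (u - z) < r -> cmod (v - z) < r ->
     c * cmod (u - v) <= cmod (X u - X v) + cmod (Y u - Y v)) ->
  (dx != 0) || (dy != 0).
Proof.
move=> sx sy c0 r0 h; apply/negPn/negP; rewrite negb_or !negbK => /andP[/eqP x0 /eqP y0].
move: sx sy; rewrite x0 y0 => sx sy.
have c40 : 0 < c / 4 by lra.
have [r1 r10 h1] := sdif_eps sx c40; have [r2 r20 h2] := sdif_eps sy c40.
have [|s [s0 sr sE]] := @exists_small_shift R z (Num.min r (Num.min r1 r2)).
  by rewrite !lt_min r0 r10.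
move: sr; rewrite !lt_min => /andP[sr /andP[sr1 sr2]].
set w := z + _ in sr sr1 sr2 sE.
have zz (q : R) : 0 < q -> cmod (z - z) < q by rewrite subrr cmod0.
have := h w z sr (zz _ r0); have := h1 w z sr1 (zz _ r10); have := h2 w z sr2 (zz _ r20).
by rewrite !mul0r !subr0 sE; nra.
Qed.

Lemma sdif_lower f z d (c r : R) : sdif f z d -> 0 < c -> 0 < r ->
  (forall u v : R[i], cmod (u - z) < r -> cmod (v - z) < r ->
     c * cmod (u - v) <= cmod (f u - f v)) -> d != 0.
Proof.
move=> sf c0 r0 h.
suff: (d != 0) || ((0 : R[i]) != 0) by rewrite eqxx orbF.
apply: (sdif_pair_lower sf (sdif_cst (0 : R[i]) z) c0 r0) => u v ur vr.
by rewrite subrr cmod0 addr0; exact: h.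
Qed.

Lemma sdif0_neq0 g d : sdif g 0 d -> d != 0 -> g 0 = 0 ->
  exists2 r : R, 0 < r & forall t, cmod t < r -> t != 0 -> g t != 0.
Proof.
move=> sg d0 g0; have /near0rP [r r0 hr] := sdif_local_inverse sg d0.
have r20 : 0 < r / 2 by lra.
have h := hr (r / 2) _; exists (r / 2) => // t tr t0.
apply: contra_neq t0 => gt; apply: (local_inverse_inj d0 (h _)) => //; first by lra.
  by rewrite cmod0.
by rewrite gt g0.
Qed.

Lemma near0CP (P : R[i] -> Prop) :
  (exists2 r : R, 0 < r & forall t, cmod t < r -> P t) ->
  \forall t \near (0 : CC R), P t.
Proof.
move=> [r r0 h]; apply/nbhsCP; exists r => // y.
by rewrite subr0; exact: h.
Qed.

(** Here [u] and [v] are reciprocals of functions with a simple pole at the puncture. The added term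
    is [c v / (1 - a v)], which vanishes there, so the pole of [1 / u] keeps its leading
    coefficient. *)
Lemma pole_keep u v d d' a c : sdif u 0 d -> d != 0 -> u 0 = 0 ->
  sdif v 0 d' -> d' != 0 -> v 0 = 0 ->
  sdif (fun t => if t == 0 then 0 else ((u t)^-1 + c * ((v t)^-1 - a)^-1)^-1) 0 d.
Proof.
move=> su d0 u0 sv d'0 v0.
have [r1 r10 h1] := sdif0_neq0 su d0 u0; have [r2 r20 h2] := sdif0_neq0 sv d'0 v0.
have sa := sdifB (sdif_cst (1 : R[i]) 0) (sdifZ a sv).
have a1 : 1 - a * v 0 != 0 by rewrite v0 mulr0 subr0 oner_neq0.
have ss := sdifM sv (sdifV sa a1).
have sb := sdifD (sdif_cst (1 : R[i]) 0) (sdifZ c (sdifM ss su)).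
have b1 : 1 + c * (v 0 * (1 - a * v 0)^-1 * u 0) != 0.
  by rewrite u0 !mulr0 addr0 oner_neq0.
have := sdifM su (sdifV sb b1); rewrite u0 !(mul0r, mulr0, addr0) invr1 mulr1.
apply: sdif_near; apply: near0CP; exists (Num.min r1 r2); first by rewrite lt_min r10.
move=> t; rewrite lt_min => /andP[t1 t2]; case: eqVneq => [->|t0].
  by rewrite u0 mul0r.
have ut := h1 t t1 t0; have vt := h2 t t2 t0.
have -> : (v t)^-1 - a = (1 - a * v t) / v t by field.
rewrite invf_div; set s := _ / (1 - _).
have -> : (u t)^-1 + c * s = (1 + c * (s * u t)) / u t by field.
by rewrite invf_div.
Qed.

(** The reciprocal is [F / (u F + c)], whose denominator equals [c] at the simple zero of [F]. *)
Lemma pole_new u F du dF c : c != 0 -> sdif u 0 du -> sdif F 0 dF -> dF != 0 -> F 0 = 0 ->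
  sdif (fun t => if t == 0 then 0 else (u t + c * (F t)^-1)^-1) 0 (dF / c).
Proof.
move=> c0 su sF d0 F0; have [r1 r10 h1] := sdif0_neq0 sF d0 F0.
have sb := sdifD (sdifM su sF) (sdif_cst c 0).
have b1 : u 0 * F 0 + c != 0 by rewrite F0 mulr0 add0r.
have := sdifM sF (sdifV sb b1); rewrite F0 !(mul0r, mulr0, addr0, add0r).
apply: sdif_near; apply: near0CP; exists r1 => // t t1; case: eqVneq => [->|t0].
  by rewrite F0 mul0r.
have Ft := h1 t t1 t0.
have -> : u t + c * (F t)^-1 = (u t * F t + c) / F t by field.
by rewrite invf_div.
Qed.

(* Inverse of the local coordinate centred at p; only meaningful for t <> 0 when p is infinity. *)
Definition cc (p : sphere R) t : R[i] := match p with None => t^-1 | Some a => a + t end.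

Lemma sdif_cc p t : t != 0 -> exists d, sdif (cc p) t d.
Proof.
move=> t0; case: p => [a|] /=.
  by exists (0 + 1); exact: (sdifD (sdif_cst a t) (sdif_id t)).
by eexists; exact: (sdifV (sdif_id t) t0).
Qed.

Lemma disc_cc p r t : t != 0 -> cmod t < r -> disc p r (Some (cc p t)).
Proof.
move=> t0 tr; case: p => [a|] /=; first by rewrite addrAC subrr add0r.
by rewrite cmodV -ltr_pdivrMr ?invr_gt0 ?cmod_gt0// invrK mul1r.
Qed.

Lemma cc_neq p t : t != 0 -> p <> Some (cc p t).
Proof.
move=> t0; case: p => //= a [] /eqP; rewrite addrC -subr_eq subrr eq_sym.
by apply/negP.
Qed.

Lemma disc_ccP p r z : 0 < r -> disc p r (Some z) -> p <> Some z ->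
  exists t, [/\ t != 0, cmod t < r & z = cc p t].
Proof.
move=> r0; case: p => [a|] /= h pz.
  exists (z - a); split => //; last by rewrite addrC subrK.
  by rewrite subr_eq0; apply/eqP => za; apply: pz; rewrite za.
have z0 : z != 0 by apply: contraTneq h => ->; rewrite cmod0 mulr0 ltr10.
exists z^-1; split; [by rewrite invr_eq0| |by rewrite invrK].
by rewrite cmodV -[_^-1]mul1r ltr_pdivrMr// cmod_gt0.
Qed.

(** [1 / (X + j Y)] in the local coordinate at [p], with the value 0 inserted at [t = 0]: a simple
    pole at [p] becomes a simple zero. *)
Definition recip (X Y : R[i] -> R[i]) (j : nat) (p : sphere R) t : R[i] :=
  if t == 0 then 0 else (X (cc p t) + j%:R * Y (cc p t))^-1.

Lemma recip0 X Y j p : recip X Y j p 0 = 0.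
Proof. by rewrite /recip eqxx. Qed.

End Poles.

(** * Punctures indexed by words, and the invariants of a stage *)

Section Construction.
Variable R : realType.
Implicit Types (X Y : R[i] -> R[i]) (p : seq bool -> sphere R) (r e : R).
Implicit Types (z t : R[i]) (w : seq bool) (k j : nat).

(** There are finitely many words of each length, so separate bounds on [e] have a common one. *)
Lemma near_words k (P : seq bool -> R -> Prop) :
  (forall w, size w = k -> \forall e \near 0^'+, P w e) ->
  \forall e \near 0^'+, forall w, size w = k -> P w e.
Proof.
elim: k P => [|k IH] P h.
  by have := h [::] erefl; apply: filterS => e he w /size0nil ->.
have h1 : \forall e \near 0^'+, forall w, size w = k -> P (true :: w) e.
  by apply: (IH (fun w => P (true :: w))) => w wk; apply: h; rewrite /= wk.
have h2 : \forall e \near 0^'+, forall w, size w = k -> P (false :: w) e.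
  by apply: (IH (fun w => P (false :: w))) => w wk; apply: h; rewrite /= wk.
by apply: filterS2 h1 h2 => e g1 g2 [//|[] w] /= [wk]; [exact: g1|exact: g2].
Qed.

Definition off k p z := forall w, size w = k -> p w <> Some z.

Definition outside k p r : set (CC R) :=
  [set z : CC R | forall w, size w = k -> ~ disc (p w) r (Some z)].

(** The exponent is chosen so that the power [1 / (k + 1)] of this bound is [4^-k], which outweighs
    the [2^k] cells of level [k]. *)
Definition rho k : R := (4^-1) ^+ (k * k.+1).

(** The newest bit of a word comes first. [adm_infty] makes the region outside the discs bounded,
    hence compact. [adm_pole] covers all [j >= k] because later shears act along [X + j Y]. *)
Record admissible k X Y p : Prop := Admissible {
  adm_inj : forall w w', size w = k -> size w' = k -> p w = p w' -> w = w';
  adm_infty : p (nseq k false) = None;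
  adm_sdif : forall z, off k p z ->
    exists dx dy, [/\ sdif X z dx, sdif Y z dy & (dx != 0) || (dy != 0)];
  adm_injXY : forall z z', off k p z -> off k p z' -> X z = X z' -> Y z = Y z' -> z = z';
  adm_pole : forall w j, size w = k -> (k <= j)%N ->
    exists2 d, d != 0 & sdif (recip X Y j (p w)) 0 d }.

(** The bound [(k + 1)(k + 2)] in [st_large] is sized so that, after division by [k + 1], one unit
    is left for the error of all later shears. [delta] serves as the budget for later changes, which
    consume only part of the lower Lipschitz constant. *)
Record stage k X Y p r (delta : R) : Prop := Stage {
  st_adm : admissible k X Y p;
  st_r : 0 < r;
  st_delta : 0 < delta;
  st_disj : forall w w' x, size w = k -> size w' = k ->
    disc (p w) r x -> disc (p w') r x -> w = w';
  st_large : forall w z, size w = k -> disc (p w) r (Some z) -> p w <> Some z ->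
    (k.+1 * k.+2)%:R <= cmod (X z + k%:R * Y z);
  st_inv : forall w, size w = k -> exists2 d, d != 0 &
    forall u v, cmod u < r -> cmod v < r ->
    cmod (recip X Y k (p w) u - recip X Y k (p w) v - d * (u - v)) <= cmod d / 2 * cmod (u - v);
  st_diam : forall q x y, disc q r x -> disc q r y -> sdist x y <= rho k;
  st_lower : forall u v, outside k p r u -> outside k p r v ->
    delta * cmod (u - v) <= cmod (X u - X v) + cmod (Y u - Y v) }.

Lemma outside_off k p r z : 0 < r -> outside k p r z -> off k p z.
Proof. by move=> r0 h w wk pw; apply: (h w wk); rewrite pw; exact: disc_center. Qed.

Lemma outside_compact k p r : 0 < r -> p (nseq k false) = None ->
  compact (outside k p r).
Proof.
move=> r0 pN; have c := @compact_cdisc R r^-1.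
refine (subclosed_compact _ c _).
  move=> z cz w wk dz.
  have /continuous_Some /cz [u [hu du]] : nbhs (Some z : sphere R) (disc (p w) r).
    by apply: open_nbhs_nbhs; split => //; exact: disc_open.
  exact: (hu w wk).
move=> z /(_ (nseq k false)); rewrite size_nseq pN => /(_ erefl) /= /negP.
by rewrite -leNgt -[r^-1]mul1r ler_pdivlMr// mulrC.
Qed.

(** With [F = X + k Y], linearization bounds [cmod (1 / F)] by [2 * cmod d * r] on the punctured
    disc, so a small radius makes [F] large. *)
Lemma near_large X Y k q : (exists2 d, d != 0 & sdif (recip X Y k q) 0 d) ->
  \forall r \near 0^'+, forall z, disc q r (Some z) -> q <> Some z ->
    (k.+1 * k.+2)%:R <= cmod (X z + k%:R * Y z).
Proof.
move=> [d d0 sd]; have hi := sdif_local_inverse sd d0.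
have dp : 0 < cmod d by rewrite cmod_gt0.
set M : R := (k.+1 * k.+2)%:R; have M0 : 0 < M by rewrite ltr0n.
have c0 : 0 < (2 * cmod d * M)^-1 by rewrite invr_gt0 !mulr_gt0.
near=> r.
have r0 : 0 < r by near: r; exact: nbhs_right_gt.
have rM : r < (2 * cmod d * M)^-1 by near: r; exact: nbhs_right_lt.
have hr : forall u v, cmod u < r -> cmod v < r ->
  cmod (recip X Y k q u - recip X Y k q v - d * (u - v)) <= cmod d / 2 * cmod (u - v).
  by near: r.
move=> z /(disc_ccP r0) h /h [t [t0 tr ->]].
have z0 : cmod (0 : R[i]) < r by rewrite cmod0.
have := hr t 0 tr z0; have := local_inverse_lower hr tr z0.
rewrite recip0 !subr0 /recip (negbTE t0); set F := X _ + _.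
have tp : 0 < cmod t by rewrite cmod_gt0.
rewrite cmodV => lo up.
(* Since [0^-1 = 0], an upper bound on the reciprocal would allow [F = 0]; the lower bound excludes
   it. *)
have Fp : 0 < cmod F.
  rewrite cmod_gt0; apply/eqP => F0; move: lo; rewrite F0 cmod0 invr0.
  have : 0 < cmod d / 2 * cmod t by rewrite mulr_gt0// divr_gt0.
  by lra.
have := cmod_sub_ge (F^-1) (d * t); rewrite cmodM cmodV => h1.
have h2 : (cmod F)^-1 <= 2 * cmod d * r by nra.
have h3 : (cmod F)^-1 <= M^-1.
  apply: le_trans h2 _.
  rewrite -[M^-1]mul1r ler_pdivlMr// mulrAC mulrC -ler_pdivlMr ?mulr_gt0// mul1r.
  exact: ltW.
by move: h3; rewrite lef_pV2 ?posrE.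
Unshelve. all: by end_near. Qed.

(** The radius is fixed first, by finitely many smallness conditions; then [delta] comes from
    compactness of the region outside the discs. [P] lets a step demand nesting in the previous
    discs. *)
Lemma stage_exists k X Y p (P : R -> Prop) (delta0 : R) :
  admissible k X Y p -> (\forall r \near 0^'+, P r) -> 0 < delta0 ->
  exists r delta, [/\ stage k X Y p r delta, P r & delta <= delta0].
Proof.
move=> adm nP d00.
have n1 : \forall r \near 0^'+, forall w, size w = k -> forall w', size w' = k ->
    forall x, disc (p w) r x -> disc (p w') r x -> w = w'.
  apply: near_words => w wk; apply: near_words => w' w'k.
  have [->|ww'] := eqVneq w w'; first by apply: nearW.
  have pp : p w != p w' by apply: contra_neq ww'; exact: (adm_inj adm).
  by have := disc_disjoint pp; apply: filterS => r h x h1 h2; case: (h x).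
have n2 : \forall r \near 0^'+, forall w, size w = k ->
    forall z, disc (p w) r (Some z) -> p w <> Some z ->
    (k.+1 * k.+2)%:R <= cmod (X z + k%:R * Y z).
  by apply: near_words => w wk; apply: near_large; exact: (adm_pole adm).
have n3 : \forall r \near 0^'+, forall w, size w = k -> exists2 d, d != 0 &
    forall u v, cmod u < r -> cmod v < r ->
    cmod (recip X Y k (p w) u - recip X Y k (p w) v - d * (u - v)) <= cmod d / 2 * cmod (u - v).
  apply: near_words => w wk; have [d d0 sd] := adm_pole adm wk (leqnn k).
  by have := sdif_local_inverse sd d0; apply: filterS => r h; exists d.
have rho0 : 0 < rho k by rewrite exprn_gt0.
have n4 := disc_sdist_small rho0.
have [r [r0 Pr h1 h2 [h3 h4]]] : exists r, [/\ 0 < r, P r,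
    (forall w, size w = k -> forall w', size w' = k ->
      forall x, disc (p w) r x -> disc (p w') r x -> w = w'),
    (forall w, size w = k -> forall z, disc (p w) r (Some z) -> p w <> Some z ->
      (k.+1 * k.+2)%:R <= cmod (X z + k%:R * Y z)) &
    (forall w, size w = k -> exists2 d, d != 0 &
      forall u v, cmod u < r -> cmod v < r ->
      cmod (recip X Y k (p w) u - recip X Y k (p w) v - d * (u - v)) <= cmod d / 2 * cmod (u - v))
    /\ (forall q x y, disc q r x -> disc q r y -> sdist x y < rho k)].
  near (0 : R)^'+ => r; exists r; split; last split.
  - by near: r; exact: nbhs_right_gt.
  - by near: r.
  - by near: r.
  - by near: r.
  - by near: r.
  - by near: r.
have cK := outside_compact r0 (adm_infty adm).
have lo : \forall e \near 0^'+, forall u v, outside k p r u -> outside k p r v ->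
    e * cmod (u - v) <= cmod (X u - X v) + cmod (Y u - Y v).
  apply: compact_lower_lipschitz => // [z /(outside_off r0)|z z'].
    exact: (adm_sdif adm).
  move=> /(outside_off r0) oz /(outside_off r0) oz'; exact: (adm_injXY adm).
have [delta [dpos ? ?]] : exists delta : R, [/\ 0 < delta, delta <= delta0 &
   forall u v, outside k p r u -> outside k p r v ->
    delta * cmod (u - v) <= cmod (X u - X v) + cmod (Y u - Y v)].
  near (0 : R)^'+ => e; exists e; split; last by near: e.
    by near: e; exact: nbhs_right_gt.
  by near: e; exact: nbhs_right_le.
exists r, delta; split => //; split => //.
- by move=> w w' x wk w'k; exact: h1.
- by move=> w z wk; exact: h2.
- by move=> q x y h h'; apply/ltW/(h4 q).
Unshelve. all: by end_near. Qed.

End Construction.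

(** * One shear *)

Section Step.
Variable R : realType.
Implicit Types (X Y : R[i] -> R[i]) (p : seq bool -> sphere R) (r e : R).
Implicit Types (z t : R[i]) (w : seq bool) (k j : nat).

(** As [delta' <= delta / 2], a change of [delta / 8] is at most [(delta - delta') / 4], so changes
    telescope. [lk_pres] holds inside the discs too and carries the largeness of [X + k Y] to the
    next stage. *)
Record link k X Y p r (delta : R) X' Y' p' r' (delta' : R) : Prop := Link {
  lk_old : forall w, p' (false :: w) = p w;
  lk_sub : forall w b, size w = k -> cdisc (p' (b :: w)) r' `<=` disc (p w) r;
  lk_delta : delta' <= delta / 2;
  lk_pres : forall z, X' z + k%:R * Y' z = X z + k%:R * Y z;
  lk_bound : forall z, outside k p r z ->
    cmod (X' z - X z) <= delta / 8 /\ cmod (Y' z - Y z) <= delta / 8;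
  lk_lip : forall u v, outside k p r u -> outside k p r v ->
    cmod (X' u - X u - (X' v - X v)) <= delta / 8 * cmod (u - v) /\
    cmod (Y' u - Y u - (Y' v - Y v)) <= delta / 8 * cmod (u - v) }.

Section Shear.
Variables (k : nat) (X Y : R[i] -> R[i]) (p : seq bool -> sphere R) (r delta : R).
Hypothesis st : stage k X Y p r delta.
Variables (b : R) (t : seq bool -> R[i]).
Let f z := X z + k%:R * Y z.
Let a : R[i] := b^-1%:C%C.
Hypothesis b0 : 0 < b.
Hypothesis tr : forall w, size w = k -> cmod (t w) < r.
Hypothesis tE : forall w, size w = k -> recip X Y k (p w) (t w) = b%:C%C.
Hypothesis fK : forall z, outside k p r z -> f z <> a.

Definition newp w : sphere R :=
  match w with
  | [::] => None
  | c :: w' => if c then Some (cc (p w') (t w')) else p w'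
  end.

Lemma aV : a^-1 = b%:C%C.
Proof. by rewrite /a fmorphV invrK. Qed.

Lemma t_neq0 w : size w = k -> t w != 0.
Proof.
move=> wk; apply/eqP => t0; have := tE wk; rewrite t0 recip0 => /esym.
by move=> /complexI /eqP; rewrite gt_eqF.
Qed.

Lemma f_new w : size w = k -> f (cc (p w) (t w)) = a.
Proof.
move=> wk; have := tE wk; rewrite /recip (negbTE (t_neq0 wk)) -aV => /invr_inj.
exact.
Qed.

Lemma new_disc w c : size w = k -> disc (p w) r (newp (c :: w)).
Proof.
move=> wk; case: c => /=; last by apply: disc_center; exact: st_r st.
by apply: disc_cc; [exact: t_neq0|exact: tr].
Qed.

(** The new puncture lies in its parent's disc, which is disjoint from the others, and it is not the
    centre. *)
Lemma new_off w : size w = k -> off k p (cc (p w) (t w)).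
Proof.
move=> wk w' w'k E; have ww' : w = w'.
  apply: (st_disj st wk w'k (new_disc true wk)); rewrite /= -E.
  exact: disc_center (st_r st).
move: E; rewrite -ww'; exact: cc_neq (t_neq0 wk).
Qed.

(** Outside the discs [fK] excludes solutions; inside a disc [1 / f] is injective in the local
    coordinate. *)
Lemma f_eq_a z : off k p z -> f z = a -> exists2 w, size w = k & z = cc (p w) (t w).
Proof.
move=> oz fz.
have /existsNP [w /not_implyP [wk /contrapT dz]] : ~ outside k p r z.
  by move=> /fK.
have [s [s0 sr zs]] := disc_ccP (st_r st) dz (oz w wk).
exists w => //; have [d d0 hd] := st_inv st wk.
suff -> : t w = s by [].
apply: (local_inverse_inj d0 hd) => //; first exact: tr.
by rewrite tE// /recip (negbTE s0) -zs -/(f z) fz aV.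
Qed.

Lemma sdif_f z : off k p z -> exists d, sdif f z d.
Proof.
move=> /(adm_sdif (st_adm st)) [dx [dy [sx sy _]]].
by eexists; exact: (sdifD sx (sdifZ k%:R sy)).
Qed.

(* The new punctures are simple zeros of [f - a], because [1 / f] has a
   nonzero derivative in the local coordinate. *)
Lemma sdif_f_new w : size w = k -> exists2 d, d != 0 & sdif f (cc (p w) (t w)) d.
Proof.
move=> wk; have [d sd] := sdif_f (new_off wk); exists d; last exact: sd.
apply/eqP => d0; rewrite d0 in sd.
have t0 := t_neq0 wk; have [dc sc] := sdif_cc (p w) t0.
have [d1 d10 hd] := st_inv st wk.
have fa : f (cc (p w) (t w)) != 0.
  by rewrite f_new// /a -(inj_eq invr_inj) -/a aV invr0 -(rmorph0 (real_complex R))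
    (inj_eq (@complexI R)) gt_eqF.
have := sdifV (sdif_comp sc sd) fa; rewrite mul0r oppr0 mul0r => sg.
have sg' : sdif (recip X Y k (p w)) (t w) 0.
  apply: sdif_near sg; apply/(@nbhsCP R (t w)); exists (cmod (t w)).
    by rewrite cmod_gt0.
  move=> y yt; rewrite /recip; case: eqVneq => [y0|//].
  by move: yt; rewrite y0 sub0r cmodN ltxx.
have c0 : 0 < cmod d1 / 2 by rewrite divr_gt0// cmod_gt0.
have r0 : 0 < r - cmod (t w) by rewrite subr_gt0; exact: tr.
suff : (0 : R[i]) != 0 by rewrite eqxx.
apply: (sdif_lower sg' c0 r0) => u v ut vt.
apply: (local_inverse_lower hd).
  by have := cmod_sub_ge u (t w); lra.
by have := cmod_sub_ge v (t w); lra.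
Qed.

Variable eps : R[i].
Hypothesis eps0 : eps != 0.
Definition shearh z := eps * (f z - a)^-1.
Definition shearX z := X z - k%:R * shearh z.
Definition shearY z := Y z + shearh z.

Lemma shear_pres z : shearX z + k%:R * shearY z = f z.
Proof. by rewrite /shearX /shearY /f; ring. Qed.

Lemma off_new z : off k.+1 newp z -> off k p z /\ f z != a.
Proof.
move=> oz; have oz' : off k p z.
  by move=> w wk; apply: (oz (false :: w)); rewrite /= wk.
split=> //; apply/eqP => /(f_eq_a oz') [w wk zw].
by apply: (oz (true :: w)); rewrite /= ?wk ?zw.
Qed.

(** The image point determines [f], hence [h], hence the old image point; the same argument applies
    to derivatives. *)
Lemma shear_admissible : admissible k.+1 shearX shearY newp.
Proof.
have adm := st_adm st; split.
- move=> [//|c w] [//|c' w'] /= [wk] [w'k] E.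
  have ww' : w = w'.
    apply: (st_disj st wk w'k (new_disc c wk)); rewrite /newp E; exact: (new_disc c' w'k).
  rewrite -ww' in E *; congr (_ :: _).
  have cn := @cc_neq R (p w) _ (t_neq0 wk).
  by case: c c' E => [] [] // /= E; exfalso; apply: cn.
- exact: (adm_infty adm).
- move=> z /off_new [oz fa].
  have [dx [dy [sx sy dxy]]] := adm_sdif adm oz.
  have fa0 : f z - a != 0 by rewrite subr_eq0.
  have sf := sdifD sx (sdifZ k%:R sy).
  have := sdifZ eps (sdifV (sdifB sf (sdif_cst a z)) fa0).
  set dh := eps * _ => sh; exists (dx - k%:R * dh), (dy + dh); split.
  + exact: (sdifB sx (sdifZ k%:R sh)).
  + exact: (sdifD sy sh).
  apply/negPn/negP; rewrite negb_or !negbK => /andP[/eqP e1 /eqP e2].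
  (* The combination with weight [k] is the derivative of [f], which the shear preserves. If it
     vanishes, so does [dh], and the old derivatives vanish as well. *)
  have e3 : dx + k%:R * dy = 0.
    have -> : dx + k%:R * dy = (dx - k%:R * dh) + k%:R * (dy + dh) by ring.
    by rewrite e1 e2 mulr0 addr0.
  have dh0 : dh = 0 by rewrite /dh e3 subr0 oppr0 mul0r mulr0.
  by move: e1 e2 dxy; rewrite dh0 mulr0 subr0 addr0 => -> ->; rewrite eqxx.
- move=> z z' /off_new [oz _] /off_new [oz' _] eX eY.
  have ef : f z = f z' by rewrite -!shear_pres eX eY.
  have eh : shearh z = shearh z' by rewrite /shearh ef.
  apply: (adm_injXY adm) => //.
    by apply: (addIr (- (k%:R * shearh z))); rewrite {2}eh.
  by apply: (addIr (shearh z)); rewrite {2}eh.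
- move=> [//|c w] j /= [wk] kj.
  have kj' : (k <= j)%N by exact: ltnW.
  have [d d0 sd] := adm_pole adm wk kj'.
  have [d' d'0 sd'] := adm_pole adm wk (leqnn k).
  (* The shear changes [X + j Y] by [(j - k) h]; as [j > k], the coefficient is nonzero. *)
  pose cj := (j - k)%:R * eps.
  have EX z : shearX z + j%:R * shearY z = X z + j%:R * Y z + cj * (f z - a)^-1.
    by rewrite /shearX /shearY /cj natrB// /shearh; ring.
  (* An inherited puncture keeps its pole, since [h] tends to 0 where [f] has a pole. *)
  case: c => /=; last first.
    exists d; first exact: d0.
    have := pole_keep a cj sd d0 (recip0 _ _ _ _) sd' d'0 (recip0 _ _ _ _).
    apply: sdif_near; apply: near0CP; exists 1 => // s _.
    by rewrite /recip; case: eqVneq => [//|s0]; rewrite !invrK EX.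
  (* At a new puncture the old [X + j Y] is regular and [f - a] has a simple zero, so [h] creates
     the pole. *)
  have oz := new_off wk; set z := cc (p w) (t w) in oz *.
  have [df df0 sf] := sdif_f_new wk.
  have [dx [dy [sx sy _]]] := adm_sdif adm oz.
  have cj0 : cj != 0 by rewrite /cj mulf_neq0// pnatr_eq0 -lt0n subn_gt0.
  exists (df / cj); first by rewrite mulf_neq0// invr_eq0.
  have ss : sdif (fun s : R[i] => z + s) 0 1.
    by have := sdifD (sdif_cst z (0 : R[i])) (sdif_id (0 : R[i])); rewrite add0r.
  have su : exists du, sdif (fun s => X (z + s) + j%:R * Y (z + s)) 0 du.
    eexists; apply: (sdif_comp (g := fun z => X z + j%:R * Y z) ss).
    by rewrite addr0; exact: (sdifD sx (sdifZ j%:R sy)).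
  have [du {}su] := su.
  have sF : sdif (fun s => f (z + s) - a) 0 df.
    rewrite -[df]mulr1; apply: (sdif_comp (g := fun z => f z - a) ss).
    by rewrite addr0 -[df]subr0; exact: (sdifB sf (sdif_cst a z)).
  have F0 : f (z + 0) - a = 0 by rewrite addr0 f_new// subrr.
  have := pole_new cj0 su sF df0 F0.
  apply: sdif_near; apply: near0CP; exists 1 => // s _.
  by rewrite /recip; case: eqVneq => [//|s0]; rewrite EX.
Qed.

End Shear.

(** Order of choices: [b], so small that [f = 1 / b] is solvable in every disc and nowhere outside;
    then [eps], from bounds on [1 / (f - a)] over the compact outer region; finally the new radius
    and [delta']. *)
Lemma stage_step k X Y p r delta : stage k X Y p r delta ->
  exists X' Y' p' r' delta', stage k.+1 X' Y' p' r' delta' /\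
    link k X Y p r delta X' Y' p' r' delta'.
Proof.
move=> st; have adm := st_adm st; have r0 := st_r st; have dp := st_delta st.
pose f z := X z + k%:R * Y z.
have cK := outside_compact r0 (adm_infty adm).
have sf z : outside k p r z -> exists d, sdif f z d.
  by move=> /(outside_off r0) oz; exact: (sdif_f st oz).
have /near0rP [e1 e10 he1] := compact_bound cK sf.
have n1 : \forall b \near 0^'+, forall w, size w = k ->
    exists s, cmod s < r /\ recip X Y k (p w) s = b%:C%C.
  apply: near_words => w wk; have [d d0 hd] := st_inv st wk.
  apply/near0rP; exists (cmod d * r / 8); first by rewrite !divr_gt0// mulr_gt0// cmod_gt0.
  move=> b /andP[b0 bd].
  have [|s sr sE] := local_inverse_surj d0 r0 hd (b := b%:C%C) (recip0 _ _ _ _).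
    by rewrite cmodR gtr0_norm.
  by exists s.
have [b [b0 be1 hb]] : exists b : R, [/\ 0 < b, b < e1 / 2 & forall w, size w = k ->
    exists s, cmod s < r /\ recip X Y k (p w) s = b%:C%C].
  near (0 : R)^'+ => b; exists b; split; last by near: b.
    by near: b; exact: nbhs_right_gt.
  by near: b; apply: nbhs_right_lt; rewrite divr_gt0.
have /choice [t ht] : forall w, exists s, size w = k ->
    cmod s < r /\ recip X Y k (p w) s = b%:C%C.
  move=> w; have [/eqP wk|wk] := boolP (size w == k).
    by have [s hs] := hb w wk; exists s.
  by exists 0 => /eqP; rewrite (negbTE wk).
have tr w (wk : size w = k) : cmod (t w) < r by have [] := ht w wk.
have tE w (wk : size w = k) : recip X Y k (p w) (t w) = b%:C%C by have [] := ht w wk.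
have fK z : outside k p r z -> f z <> b^-1%:C%C.
  (* Taking [e = 2 b < e1] in the bound gives [cmod (f z) <= 1 / (2 b)], which is below [1 / b]. *)
  move=> oz fz; have := he1 (2 * b) _ z oz; rewrite fz cmodR gtr0_norm ?invr_gt0//.
  rewrite mulfK ?gt_eqF// => /(_ _); have : 0 < 2 * b < e1 by lra.
  by move=> h /(_ h); lra.
pose h0 z := (f z - b^-1%:C%C)^-1.
have sh0 z : outside k p r z -> exists d, sdif h0 z d.
  move=> oz; have [d sd] := sf z oz; eexists.
  apply: (sdifV (sdifB sd (sdif_cst _ z))).
  by rewrite subr_eq0; apply/eqP; exact: fK.
have n2 := compact_bound cK sh0; have n3 := compact_lipschitz cK sh0.
have [e [e0 he hL]] : exists e : R, [/\ 0 < e,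
   (forall u, outside k p r u -> e * cmod (h0 u) <= 1) &
   (forall u v, outside k p r u -> outside k p r v -> e * cmod (h0 u - h0 v) <= cmod (u - v))].
  near (0 : R)^'+ => e; exists e; split; [|by near: e|by near: e].
  by near: e; exact: nbhs_right_gt.
(* The factor [k + 1] makes both [h] and [k h], the changes of [Y] and [X], at most [delta / 8]. *)
pose c : R := delta / (8 * k.+1%:R).
have c0 : 0 < c by rewrite divr_gt0// mulr_gt0// ltr0n.
have c1 : c * k.+1%:R = delta / 8 by rewrite /c invfM mulrA divfK// pnatr_eq0.
have eps0 : (e * c)%:C%C != 0 :> R[i].
  by rewrite -(rmorph0 (real_complex R)) (inj_eq (@complexI R)) gt_eqF// mulr_gt0.
have adm' := shear_admissible st b0 tr tE fK eps0.
set X' := shearX _ _ _ _ _ in adm'; set Y' := shearY _ _ _ _ _ in adm'.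
set p' := newp _ _ in adm'.
have n4 : \forall r' \near 0^'+, forall w, size w = k.+1 ->
    cdisc (p' w) r' `<=` disc (p (behead w)) r.
  apply: near_words => -[//|c' w] /= [wk]; apply: disc_shrink => //.
  exact: (new_disc st b0 tr tE).
have d20 : 0 < delta / 2 by lra.
have [r' [delta' [st' hr' dd]]] := stage_exists adm' n4 d20.
exists X', Y', p', r', delta'; split => //.
have hE z : shearh k X Y b (e * c)%:C%C z = (e * c)%:C%C * h0 z by [].
have hX z : X' z - X z = - (k%:R * ((e * c)%:C%C * h0 z)) by rewrite /X' /shearX hE; ring.
have hY z : Y' z - Y z = (e * c)%:C%C * h0 z by rewrite /Y' /shearY hE; ring.
have ec0 : 0 < e * c by rewrite mulr_gt0.
have k1 : (k.+1%:R : R) = k%:R + 1 by rewrite -natr1.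
have k0 : 0 <= k%:R :> R by rewrite ler0n.
rewrite k1 in c1.
split => //.
- by move=> w c' wk; have := hr' (c' :: w); rewrite /= wk => /(_ erefl).
- by move=> z; rewrite shear_pres.
- move=> z oz; have h1 := ler_wpM2l (ltW c0) (he z oz).
  rewrite hX hY cmodN !cmodM cmodR gtr0_norm// cmod_nat.
  have h2 := ler_wpM2l k0 h1; have h3 := cmod_ge0 (h0 z).
  have h4 := mulr_ge0 k0 (ltW c0).
  by split; lra.
- move=> u v ou ov; have h1 := ler_wpM2l (ltW c0) (hL u v ou ov).
  rewrite !hX !hY.
  have -> : - (k%:R * ((e * c)%:C%C * h0 u)) - - (k%:R * ((e * c)%:C%C * h0 v)) =
    - (k%:R * ((e * c)%:C%C * (h0 u - h0 v))) by ring.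
  have -> : (e * c)%:C%C * h0 u - (e * c)%:C%C * h0 v = (e * c)%:C%C * (h0 u - h0 v) by ring.
  rewrite cmodN !cmodM cmodR gtr0_norm// cmod_nat.
  have h2 := ler_wpM2l k0 h1.
  have h4 := mulr_ge0 k0 (ltW c0); have h5 := cmod_ge0 (u - v).
  have h6 := mulr_ge0 h4 h5; have h7 := mulr_ge0 (ltW c0) h5.
  have h8 : (c * (k%:R + 1)) * cmod (u - v) = delta / 8 * cmod (u - v) by rewrite c1.
  by split; lra.
Unshelve. all: by end_near. Qed.

Lemma stage0 : exists r delta, stage 0 id (fun=> 0) (fun=> None) r delta /\ delta <= 1.
Proof.
have adm : admissible 0 id (fun=> 0 : R[i]) (fun=> None).
  split => //.
  - by move=> w w' /size0nil -> /size0nil ->.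
  - move=> z _; exists 1, 0; split; [exact: sdif_id|exact: sdif_cst|].
    by rewrite oner_neq0.
  - move=> w j _ _; exists 1; first exact: oner_neq0.
    have := sdif_id (0 : R[i]); apply: sdif_near; apply: near0CP; exists 1 => // t _.
    by rewrite /recip /=; case: eqVneq => [//|t0]; rewrite mulr0 addr0 invrK.
have nT : \forall r \near (0 : R)^'+, True by apply: nearW.
have [r [delta [st _ d1]]] := stage_exists adm nT ltr01.
by exists r, delta.
Qed.

End Step.

(** * The limit map *)

Section Limit.
Variable R : realType.

Lemma stages_exist : exists (X Y : nat -> R[i] -> R[i]) (p : nat -> seq bool -> sphere R)
    (r delta : nat -> R),
  [/\ forall k, stage k (X k) (Y k) (p k) (r k) (delta k),
      forall k, link k (X k) (Y k) (p k) (r k) (delta k)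
        (X k.+1) (Y k.+1) (p k.+1) (r k.+1) (delta k.+1) &
      delta 0%N <= 1].
Proof.
pose S := ((R[i] -> R[i]) * (R[i] -> R[i]) * (seq bool -> sphere R) * R * R)%type.
pose stg k (s : S) := stage k s.1.1.1.1 s.1.1.1.2 s.1.1.2 s.1.2 s.2.
pose lnk k (s s' : S) := link k s.1.1.1.1 s.1.1.1.2 s.1.1.2 s.1.2 s.2
  s'.1.1.1.1 s'.1.1.1.2 s'.1.1.2 s'.1.2 s'.2.
(* The successor is made total, invalid states being kept as they are, so that plain choice and
   recursion apply. *)
have /choice [nxt hn] : forall ks : nat * S, exists s' : S,
    stg ks.1 ks.2 -> stg ks.1.+1 s' /\ lnk ks.1 ks.2 s'.
  move=> [k s]; have [h|h] := pselect (stg k s); last by exists s.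
  have [X' [Y' [p' [r' [d' h']]]]] := stage_step h.
  by exists (X', Y', p', r', d').
have [r0 [d0 [st0 d01]]] := @stage0 R.
pose fix s k : S := if k is k'.+1 then nxt (k', s k') else (id, fun=> 0, fun=> None, r0, d0).
have hs k : stg k (s k) by elim: k => [//|k IH]; have [] := hn (k, s k) IH.
exists (fun k => (s k).1.1.1.1), (fun k => (s k).1.1.1.2), (fun k => (s k).1.1.2),
  (fun k => (s k).1.2), (fun k => (s k).2).
by split => // k; have [_] := hn (k, s k) (hs k).
Qed.

Variables (X Y : nat -> R[i] -> R[i]) (p : nat -> seq bool -> sphere R) (r delta : nat -> R).
Hypothesis st : forall k, stage k (X k) (Y k) (p k) (r k) (delta k).
Hypothesis lk : forall k, link k (X k) (Y k) (p k) (r k) (delta k)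
        (X k.+1) (Y k.+1) (p k.+1) (r k.+1) (delta k.+1).
Hypothesis delta1 : delta 0%N <= 1.

Definition cell k w : set (sphere R) := disc (p k w) (r k).
Definition cells k : set (sphere R) := [set x | exists2 w, size w = k & cell k w x].
Definition cantorC : set (sphere R) := [set x | forall k, cells k x].
Let out k := outside k (p k) (r k).

Lemma cell_sub k b w : size w = k -> cell k.+1 (b :: w) `<=` cell k w.
Proof.
by move=> wk x /disc_sub_cdisc; exact: (lk_sub (lk k)).
Qed.

Lemma cells_le k m : (k <= m)%N -> cells m `<=` cells k.
Proof.
move=> /subnKC <-; elim: (m - k)%N => [|n IH]; first by rewrite addn0.
rewrite addnS => x [[//|b w] /= [wk] h]; apply: IH; exists w => //.
exact: cell_sub h.
Qed.

Lemma cell_inj k w w' x : size w = k -> size w' = k ->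
  cell k w x -> cell k w' x -> w = w'.
Proof. by move=> wk w'k; exact: (st_disj (st k)). Qed.

(** A puncture is inherited under the word with [false] prepended, so it is the centre of a cell at
    every later level. *)
Lemma puncture_cantorC k w : size w = k -> cantorC (p k w).
Proof.
move=> wk m; apply: (@cells_le m (k + m)); first exact: leq_addl.
exists (nseq m false ++ w); first by rewrite size_cat size_nseq wk addnC.
have -> : p k w = p (k + m) (nseq m false ++ w).
  elim: m => [|m IH]; first by rewrite addn0.
  by rewrite IH addnS /= (lk_old (lk _)).
exact: disc_center (st_r (st _)).
Qed.

Lemma None_cantorC : cantorC None.
Proof.
have := @puncture_cantorC 0 (nseq 0 false) erefl.
by rewrite (adm_infty (st_adm (st 0))).
Qed.

Lemma outP k z : out k z <-> ~ cells k (Some z).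
Proof.
split=> [h [w wk cw]|h w wk dw]; first exact: (h w).
by apply: h; exists w.
Qed.

Lemma out_le k m z : (k <= m)%N -> out k z -> out m z.
Proof. by move=> km /outP h; apply/outP => /(cells_le km). Qed.

Lemma not_cantorC z : ~ cantorC (Some z) -> exists k, out k z.
Proof. by move=> /existsNP [k h]; exists k; apply/outP. Qed.

Lemma out_not_cantorC k z : out k z -> ~ cantorC (Some z).
Proof. by move=> /outP h /(_ k). Qed.

Lemma out_off k z : out k z -> off k (p k) z.
Proof. exact: outside_off (st_r (st k)). Qed.

(** Closed cells of level [k + 1] lie in open cells of level [k], so a point outside the latter has
    a whole neighbourhood outside the former. *)
Lemma out_nbhs k z : out k z ->
  exists2 e : R, 0 < e & forall u, cmod (u - z) < e -> out k.+1 u.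
Proof.
move=> oz.
have : \forall e \near 0^'+, forall w, size w = k.+1 ->
    forall y, disc (Some z) e y -> ~ cdisc (p k.+1 w) (r k.+1) y.
  apply: near_words => -[//|b w] [wk]; apply: cdisc_sep; first exact: st_r (st _).
  by move=> h; apply: (oz w wk); exact: (lk_sub (lk k) wk h).
move=> /near0rP [e e0 he]; exists (e / 2); first lra.
move=> u uz w wk /disc_sub_cdisc; apply: (he (e / 2) _ w wk (Some u)) => //; lra.
Qed.

Lemma delta_gt0 k : 0 < delta k. Proof. exact: st_delta (st k). Qed.

Lemma delta_le m n : (m <= n)%N -> delta n <= delta m.
Proof.
move=> /subnKC <-; elim: (n - m)%N => [|i IH]; first by rewrite addn0.
rewrite addnS; have := lk_delta (lk (m + i)); have := delta_gt0 (m + i); lra.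
Qed.

Lemma delta_le1 k : delta k <= 1.
Proof. exact: le_trans (delta_le (leq0n k)) delta1. Qed.

Lemma delta_inv k : delta k * k.+1%:R <= 1.
Proof.
elim: k => [|k IH]; first by rewrite mulr1.
have := lk_delta (lk k); have := delta_gt0 k; have := delta_gt0 k.+1.
move: IH; rewrite -(natr1 k.+1) -(natr1 k); have : 0 <= k%:R :> R by [].
nra.
Qed.

Lemma delta_small k e : 0 < e -> exists2 m, (k <= m)%N & delta m < e.
Proof.
move=> e0; pose n := Num.bound e^-1; exists (maxn k n); first exact: leq_maxl.
apply: le_lt_trans (delta_le (leq_maxr k n)) _.
have h : e^-1 < n%:R by apply: archi_boundP; rewrite invr_ge0 ltW.
have n1 : 0 < n.+1%:R :> R by [].
have := delta_inv n; rewrite -ler_pdivlMr// mul1r => h1.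
apply: le_lt_trans h1 _; rewrite -[e]invrK ltf_pV2 ?posrE ?invr_gt0//.
by apply: lt_trans h _; rewrite ltr_nat.
Qed.

(** Telescoping: step [i] costs [delta i / 8 <= (delta i - delta i.+1) / 4]. *)
Lemma increment k m n z : out k z -> (k <= m)%N -> (m <= n)%N ->
  cmod (X n z - X m z) <= (delta m - delta n) / 4 /\
  cmod (Y n z - Y m z) <= (delta m - delta n) / 4.
Proof.
move=> oz km /subnKC <-; elim: (n - m)%N => [|i [h1 h2]].
  by rewrite addn0 !subrr cmod0 mul0r.
rewrite addnS; have oz' : out (m + i) z by apply: out_le oz; exact: leq_trans km (leq_addr _ _).
have [g1 g2] := lk_bound (lk (m + i)) oz'.
have := cmodBD (X (m + i).+1 z) (X (m + i) z) (X m z).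
have := cmodBD (Y (m + i).+1 z) (Y (m + i) z) (Y m z).
by have := lk_delta (lk (m + i)); split; lra.
Qed.

Lemma increment_lip k m n (u v : R[i]) : out k u -> out k v -> (k <= m)%N -> (m <= n)%N ->
  cmod (X n u - X m u - (X n v - X m v)) <= (delta m - delta n) / 4 * cmod (u - v) /\
  cmod (Y n u - Y m u - (Y n v - Y m v)) <= (delta m - delta n) / 4 * cmod (u - v).
Proof.
move=> ou ov km /subnKC <-; elim: (n - m)%N => [|i [h1 h2]].
  by rewrite addn0 !subrr cmod0 !mul0r.
have kmi : (k <= m + i)%N by exact: leq_trans km (leq_addr _ _).
rewrite addnS; have [g1 g2] := lk_lip (lk (m + i)) (out_le kmi ou) (out_le kmi ov).
have split3 (Z : nat -> R[i] -> R[i]) i' j' : Z j' u - Z m u - (Z j' v - Z m v) =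
  (Z j' u - Z i' u - (Z j' v - Z i' v)) + (Z i' u - Z m u - (Z i' v - Z m v)) by ring.
have := ler_wpM2r (cmod_ge0 (u - v)) (lk_delta (lk (m + i))).
rewrite (split3 X (m + i)%N) (split3 Y (m + i)%N) => h3; split.
  by apply: le_trans (cmodD _ _) _; lra.
by apply: le_trans (cmodD _ _) _; lra.
Qed.

Lemma limit_exists (Z : nat -> R[i] -> R[i]) :
  (forall k m n z, out k z -> (k <= m)%N -> (m <= n)%N ->
     cmod (Z n z - Z m z) <= (delta m - delta n) / 4) ->
  exists L : R[i] -> R[i], forall k z, out k z -> cmod (L z - Z k z) <= delta k / 4.
Proof.
move=> hZ.
suff /choice [L hL] : forall z, exists l, forall k, out k z -> cmod (l - Z k z) <= delta k / 4.
  by exists L => k z; exact: hL.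
move=> z; have [h|nh] := pselect (exists k, out k z); last first.
  by exists 0 => k ok; exfalso; apply: nh; exists k.
have h' : exists k, `[< out k z >] by have [k ok] := h; exists k; apply/asboolP.
(* Starting at the first level where [z] is outside gives one limit that serves all admissible
   [k]. *)
case: (ex_minnP h') => k0 /asboolP ok0 kmin.
have [l hl] : exists l, forall m, (k0 <= m)%N -> cmod (l - Z m z) <= delta m / 4.
  apply: cauchy_limit => m n km mn.
  by have := hZ k0 m n z ok0 km mn; have := delta_gt0 n; lra.
by exists l => k ok; apply: hl; apply: kmin; apply/asboolP.
Qed.

(** * The limit is a proper holomorphic embedding *)

Section WithLimit.
Variables (LX LY : R[i] -> R[i]).
Hypothesis hX : forall k z, out k z -> cmod (LX z - X k z) <= delta k / 4.
Hypothesis hY : forall k z, out k z -> cmod (LY z - Y k z) <= delta k / 4.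

(** At both points the limit is within [delta n / 4] of stage [n], and [delta n] tends to 0, so the
    Lipschitz bound between stages passes to the limit. *)
Lemma tail_lip_gen (Z : nat -> R[i] -> R[i]) (L : R[i] -> R[i]) k m (u v : R[i]) :
  (forall n, (m <= n)%N ->
    cmod (Z n u - Z m u - (Z n v - Z m v)) <= (delta m - delta n) / 4 * cmod (u - v)) ->
  (forall k z, out k z -> cmod (L z - Z k z) <= delta k / 4) ->
  out k u -> out k v -> (k <= m)%N ->
  cmod (L u - Z m u - (L v - Z m v)) <= delta m / 4 * cmod (u - v).
Proof.
move=> hZ hL ou ov km; apply/ler_addgt0Pl => e e0.
have [n mn dn] := delta_small m e0.
have kn := leq_trans km mn.
have := hL n u (out_le kn ou); have := hL n v (out_le kn ov); have := hZ n mn.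
have -> : L u - Z m u - (L v - Z m v) =
  (Z n u - Z m u - (Z n v - Z m v)) + (L u - Z n u) - (L v - Z n v) by ring.
have := cmodB ((Z n u - Z m u - (Z n v - Z m v)) + (L u - Z n u)) (L v - Z n v).
have := cmodD (Z n u - Z m u - (Z n v - Z m v)) (L u - Z n u).
by have := mulr_ge0 (ltW (delta_gt0 n)) (cmod_ge0 (u - v)); lra.
Qed.

Lemma tail_lip k m (u v : R[i]) : out k u -> out k v -> (k <= m)%N ->
  cmod (LX u - X m u - (LX v - X m v)) <= delta m / 4 * cmod (u - v) /\
  cmod (LY u - Y m u - (LY v - Y m v)) <= delta m / 4 * cmod (u - v).
Proof.
move=> ou ov km; split.
  apply: (@tail_lip_gen X LX k) => // n mn.
  by have [] := increment_lip ou ov km mn.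
apply: (@tail_lip_gen Y LY k) => // n mn.
by have [] := increment_lip ou ov km mn.
Qed.

(** Stage [k] has the lower constant [delta k], and the tail takes at most [delta k / 4] from each
    coordinate. *)
Lemma limit_lower k (u v : R[i]) : out k u -> out k v ->
  delta k / 2 * cmod (u - v) <= cmod (LX u - LX v) + cmod (LY u - LY v).
Proof.
move=> ou ov; have := st_lower (st k) ou ov; have [h1 h2] := tail_lip ou ov (leqnn k).
have := cmod_sub_ge (X k u - X k v) (LX u - LX v).
have := cmod_sub_ge (Y k u - Y k v) (LY u - LY v).
have E (Z : nat -> R[i] -> R[i]) (L : R[i] -> R[i]) :
  cmod (Z k u - Z k v - (L u - L v)) = cmod (L u - Z k u - (L v - Z k v)).
  by rewrite -cmodN; congr cmod; ring.
by rewrite !E; lra.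
Qed.

Lemma limit_sdif k z : out k z ->
  exists dx dy, [/\ sdif LX z dx, sdif LY z dy & (dx != 0) || (dy != 0)].
Proof.
move=> oz; have [e e0 he] := out_nbhs oz.
have sm m : (k.+1 <= m)%N -> exists dx dy, sdif (X m) z dx /\ sdif (Y m) z dy.
  move=> km; have oz' : out m z by apply: out_le oz; exact: ltnW.
  by have [dx [dy [sx sy _]]] := adm_sdif (st_adm (st m)) (out_off oz'); exists dx, dy.
have dec m n : (k.+1 <= m)%N -> (m <= n)%N -> delta n / 4 <= delta m / 4.
  by move=> _ /delta_le; lra.
have sml (e1 : R) : 0 < e1 -> exists2 m, (k.+1 <= m)%N & delta m / 4 < e1.
  move=> e10; have [m km dm] := delta_small k.+1 e10; exists m => //.
  by have := delta_gt0 m; lra.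
have [dx sx] : exists dx, sdif LX z dx.
  apply: (@sdif_limit R LX X (fun m => delta m / 4) z e k.+1) => //.
    by move=> m /sm [dx [dy [sx _]]]; exists dx.
  by move=> m u v km ue ve; have [] := tail_lip (he u ue) (he v ve) km.
have [dy sy] : exists dy, sdif LY z dy.
  apply: (@sdif_limit R LY Y (fun m => delta m / 4) z e k.+1) => //.
    by move=> m /sm [dx' [dy [_ sy]]]; exists dy.
  by move=> m u v km ue ve; have [] := tail_lip (he u ue) (he v ve) km.
exists dx, dy; split => //.
have c0 : 0 < delta k.+1 / 2 by rewrite divr_gt0// delta_gt0.
apply: (sdif_pair_lower sx sy c0 e0) => u v ue ve.
by apply: limit_lower; exact: he.
Qed.

Lemma limit_inj z w : ~ cantorC (Some z) -> ~ cantorC (Some w) ->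
  LX z = LX w -> LY z = LY w -> z = w.
Proof.
move=> /not_cantorC [k ok] /not_cantorC [m om] eX eY.
have := limit_lower (out_le (leq_maxl k m) ok) (out_le (leq_maxr k m) om).
rewrite eX eY !subrr cmod0 addr0 pmulr_rle0 ?divr_gt0 ?delta_gt0// => h.
by apply/eqP; rewrite -subr_eq0 -cmod_eq0 eq_le h cmod_ge0.
Qed.

(** Let [m >= k] be the last level with [z] in a cell. Stage [m] makes [X + m Y] large at [z], the
    shear at [m] preserves it, and [z] is outside from level [m + 1] on, so the limit is close to
    stage [m + 1]. *)
Lemma limit_large k z : ~ cantorC (Some z) -> cells k (Some z) ->
  k.+1%:R <= cmod (LX z) + cmod (LY z).
Proof.
move=> nC ck.
have [m [km cm ncm]] : exists m, [/\ (k <= m)%N, cells m (Some z) & ~ cells m.+1 (Some z)].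
  apply: contrapT => h; apply: nC => m; apply: (@cells_le m (k + m)); first exact: leq_addl.
  elim: m => [|m IH]; first by rewrite addn0.
  rewrite addnS; apply: contrapT => nc; apply: h.
  by exists (k + m)%N; split => //; exact: leq_addr.
have om : out m.+1 z by apply/outP.
have [w wm dw] := cm.
have pz : p m w <> Some z by move=> pz; apply: nC; rewrite -pz; exact: puncture_cantorC.
have := st_large (st m) wm dw pz; rewrite -(lk_pres (lk m)) natrM.
have := cmodD (X m.+1 z) (m%:R * Y m.+1 z); rewrite [cmod (_ * _)]cmodM cmod_nat.
have := hX om; have := hY om; have := delta_le1 m.+1.
have := cmod_sub_ge (X m.+1 z) (LX z); have := cmod_sub_ge (Y m.+1 z) (LY z).
rewrite (cmodBC (X _ _)) (cmodBC (Y _ _)).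
have x0 := cmod_ge0 (X m.+1 z); have y0 := cmod_ge0 (Y m.+1 z).
have m0 : 0 <= m%:R :> R by [].
have km' : k%:R <= m%:R :> R by rewrite ler_nat.
rewrite -!(natr1 m.+1) -!(natr1 m) -(natr1 k).
move=> h1 h2 h3 h4 h5 h6 h7.
(* Uses [(m + 1)(m + 2) <= |X| + m |Y| <= (m + 1)(|X| + |Y|)] at stage [m + 1]; passing to the limit
   then costs at most [1 / 2]. *)
have h8 : (m%:R + 1 + 1 : R) <= cmod (X m.+1 z) + cmod (Y m.+1 z).
  have m1 : 0 < m%:R + 1 :> R by lra.
  rewrite -(ler_pM2l m1); have := mulr_ge0 m0 x0; lra.
lra.
Qed.

Definition limit_map (x : sphere R) : CC R * CC R :=
  match x with Some z => (LX z, LY z) | None => (0, 0) end.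

Lemma limit_map_continuous k z : out k z ->
  {for z, continuous (fun w : CC R => (LX w, LY w) : CC R * CC R)}.
Proof.
move=> /limit_sdif [dx [dy [/sdif_continuous sx /sdif_continuous sy _]]].
move=> A [[B1 B2] [/= n1 n2] s].
have [e1 e10 h1] := (nbhsCP _ _).1 (sx _ n1).
have [e2 e20 h2] := (nbhsCP _ _).1 (sy _ n2).
apply/nbhsCP; exists (Num.min e1 e2); first by rewrite lt_min e10.
move=> y; rewrite lt_min => /andP[y1 y2]; apply: s.
by split; [exact: h1|exact: h2].
Qed.

Lemma compact_bounded_pair (K : set (CC R * CC R)) : compact K ->
  exists M : R, forall v, K v -> cmod v.1 + cmod v.2 <= M.
Proof.
move=> cK; have [K0|/set0P/negP] := pselect (K !=set0); last first.
  by rewrite negbK => /eqP ->; exists 0.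
have c1 : continuous ((fun z : CC R => cmod z) \o (fst : CC R * CC R -> CC R)).
  by move=> v; apply: continuous_comp; [exact: cvg_fst|exact: continuous_cmod].
have c2 : continuous ((fun z : CC R => cmod z) \o (snd : CC R * CC R -> CC R)).
  by move=> v; apply: continuous_comp; [exact: cvg_snd|exact: continuous_cmod].
have [a _ ha] := compact_EVT_max K0 cK (continuous_subspaceT c1).
have [b _ hb] := compact_EVT_max K0 cK (continuous_subspaceT c2).
exists (cmod a.1 + cmod b.2) => v Kv; apply: lerD.
  by apply: ha; rewrite inE.
by apply: hb; rewrite inE.
Qed.

Lemma pairC_hausdorff : hausdorff_space (CC R * CC R)%type.
Proof. exact: norm_hausdorff. Qed.

(** By [limit_large], the preimage of a bounded set avoids the cells of some level [k], so it is a
    closed subset of the compact set [out k]. *)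
Lemma limit_proper (K : set (CC R * CC R)) : compact K ->
  compact (~` cantorC `&` limit_map @^-1` K).
Proof.
move=> cK; have [M hM] := compact_bounded_pair cK.
have [k Mk] : exists k : nat, M < k%:R.
  exists (Num.bound `|M|); apply: le_lt_trans (ler_norm M) _.
  exact: archi_boundP.
pose S := [set z : CC R | out k z /\ K (LX z, LY z)].
have co : compact (out k).
  by apply: outside_compact; [exact: st_r (st k)|exact: adm_infty (st_adm (st k))].
have cS : compact S.
  apply: (subclosed_compact _ co); last by move=> z [].
  move=> z cz.
  have oz : out k z.
    apply: (compact_closed _ co); first exact: norm_hausdorff.
    by move=> B /cz [y [[oy _] By]]; exists y.
  split=> //; apply: (compact_closed pairC_hausdorff cK).
  move=> B /(limit_map_continuous oz) /cz [y [[_ Ky] By]].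
  by exists (LX y, LY y).
have -> : ~` cantorC `&` limit_map @^-1` K = (fun z : CC R => Some z : sphere R) @` S.
  apply/seteqP; split=> [[z|] /= [nC Kz]|_ [z [oz Kz] <-]].
  - exists z => //; split => //; apply/outP => ck.
    have := limit_large nC ck; have := hM _ Kz; rewrite -natr1 /=; lra.
  - by exfalso; apply: nC; exact: None_cantorC.
  - by split => //; exact: out_not_cantorC oz.
apply: continuous_compact cS; apply: continuous_subspaceT; exact: continuous_Some.
Qed.

Lemma sdif_derivableC (f : R[i] -> R[i]) (z d : R[i]) : sdif f z d ->
  derivable (fun w : CC R => f w : CC R) z 1 /\
  'D_1 (fun w : CC R => f w : CC R) z = d.
Proof. exact: sdif_derivable. Qed.

Lemma limit_embedding : proper_holomorphic_embedding (~` cantorC) limit_map.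
Proof.
have main (z : CC R) : (~` cantorC) (Some z) ->
    [/\ derivable (fun w : CC R => LX w : CC R) z 1,
        derivable (fun w : CC R => LY w : CC R) z 1 &
        'D_1 (fun w : CC R => LX w : CC R) z != 0 \/
        'D_1 (fun w : CC R => LY w : CC R) z != 0].
  move=> /not_cantorC [k /limit_sdif [dx [dy [sx sy dxy]]]].
  have [h1 h2] := sdif_derivableC sx; have [h3 h4] := sdif_derivableC sy.
  split; [exact: h1|exact: h3|].
  by case/orP: dxy => d0; [left; rewrite h2|right; rewrite h4].
(* Infinity lies in the Cantor set, so the conditions in the chart at infinity hold vacuously. *)
have nN : ~ (~` cantorC) None by apply; exact: None_cantorC.
split.
- split; split; [|by move=> /nN| |by move=> /nN].
    by move=> z /main [h _ _]; exact: h.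
  by move=> z /main [_ h _]; exact: h.
- move=> [z|] [w|] nz nw; [|by move: nN => /(_ nw)|by move: nN => /(_ nz)|by []].
  by move=> [e1 e2]; congr Some; exact: (limit_inj nz nw).
- by split; [move=> z /main [_ _ h]; exact: h|move=> /nN].
- exact: limit_proper.
Qed.

End WithLimit.

Lemma embedding_exists : exists gamma, proper_holomorphic_embedding (~` cantorC) gamma.
Proof.
have [|LX hX] := @limit_exists X.
  by move=> k m n z oz km mn; have [] := increment oz km mn.
have [|LY hY] := @limit_exists Y.
  by move=> k m n z oz km mn; have [] := increment oz km mn.
by exists (limit_map LX LY); exact: (limit_embedding hX hY).
Qed.

End Limit.

(** * The Cantor set and its dimension *)

Section CantorScheme.
Variable R : realType.
Variables (X Y : nat -> R[i] -> R[i]) (p : nat -> seq bool -> sphere R) (r delta : nat -> R).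
Hypothesis st : forall k, stage k (X k) (Y k) (p k) (r k) (delta k).
Hypothesis lk : forall k, link k (X k) (Y k) (p k) (r k) (delta k)
        (X k.+1) (Y k.+1) (p k.+1) (r k.+1) (delta k.+1).
Let cell := cell p r.
Let C := cantorC p r.

(* First k bits, most recent first, as in the indexing of the punctures. *)
Fixpoint prefix_rev (t : nat -> bool) k : seq bool :=
  if k is k'.+1 then t k' :: prefix_rev t k' else [::].

Lemma size_prefix_rev t k : size (prefix_rev t k) = k.
Proof. by elim: k => //= k ->. Qed.

Lemma prefix_rev_inj t s : (forall k, prefix_rev t k = prefix_rev s k) -> t = s.
Proof. by move=> h; apply/funext => k; have [] := h k.+1. Qed.

(** Turns the total [2^k * 4^-k] of a cover into the bound [1 / (k + 1)], the common scale of all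
    smallness conditions below. *)
Lemma pow4_le k : (4^-1 : R) ^+ k <= 2^-1 ^+ k / k.+1%:R.
Proof.
have half_le : (2^-1 : R) ^+ k <= k.+1%:R^-1.
  elim: k => [|k IH]; first by rewrite expr0 invr1.
  rewrite exprS; apply: (@le_trans _ _ (2^-1 * k.+1%:R^-1)).
    by rewrite ler_pM2l// invr_gt0.
  rewrite -invfM lef_pV2 ?posrE ?mulr_gt0//.
  by rewrite -natrM ler_nat mul2n -addnn addSn ltnS leq_addl.
have -> : (4^-1 : R) = 2^-1 * 2^-1 by rewrite -invfM -natrM.
by rewrite exprMn ler_wpM2l// exprn_ge0.
Qed.

Lemma inv_succ_small (e : R) : 0 < e -> exists k0, forall k, (k0 <= k)%N -> k.+1%:R^-1 < e.
Proof.
move=> e0; exists (Num.bound e^-1) => k hk.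
have h : e^-1 < (Num.bound e^-1)%:R by apply: archi_boundP; rewrite invr_ge0 ltW.
rewrite -[e]invrK ltf_pV2 ?posrE ?invr_gt0//; apply: lt_le_trans h _.
by rewrite ler_nat ltnW.
Qed.

Lemma half_pow_le1 k : (2^-1 : R) ^+ k <= 1.
Proof. by rewrite exprn_ile1// ?invr_ge0// invf_le1// ler1n. Qed.

Lemma rho_gt0 k : 0 < rho R k. Proof. by rewrite exprn_gt0// invr_gt0. Qed.

Lemma rho_le k : rho R k <= k.+1%:R^-1.
Proof.
have : rho R k <= (4^-1) ^+ k.
  apply: ler_wiXn2l; first by rewrite invr_ge0.
    by rewrite invf_le1// ler1n.
  exact: leq_pmulr.
move=> h; apply: le_trans h _; apply: le_trans (pow4_le k) _.
by rewrite ler_piMl ?half_pow_le1// invr_ge0.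
Qed.

Lemma prefix_cell_le t k m : (k <= m)%N ->
  cell m (prefix_rev t m) `<=` cell k (prefix_rev t k).
Proof.
move=> /subnKC <-; elim: (m - k)%N => [|n IH]; first by rewrite addn0.
rewrite addnS => x h; apply: IH.
exact: (cell_sub lk (size_prefix_rev t (k + n)) h).
Qed.

(** A cluster point of the punctures along the branch lies in every closed cell of the branch from
    level 1 on, hence in the open cell one level up. *)
Lemma branch_exists t : exists x, forall k, cell k (prefix_rev t k) x.
Proof.
pose F : set_system (sphere R) := (fun n => p n (prefix_rev t n)) @ \oo.
have FF : ProperFilter F by apply: fmap_proper_filter.
have [x [_ cx]] := @sphere_compact R F FF filterT.
exists x => k; apply: (lk_sub (lk k) (size_prefix_rev t k) (b := t k)).
apply: (cdisc_closed (st_r (st k.+1))) => B nB.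
have [y [h1 h2]] : cell k.+1 (prefix_rev t k.+1) `&` B !=set0.
  apply: cx => //; exists k.+1 => // n /= kn.
  by apply: (prefix_cell_le kn); exact: disc_center (st_r (st n)).
by exists y; split => //; exact: disc_sub_cdisc h1.
Qed.

Lemma branch_unique t x y : (forall k, cell k (prefix_rev t k) x) ->
  (forall k, cell k (prefix_rev t k) y) -> x = y.
Proof.
move=> hx hy; apply: sdist_eq0_sep => e e0; have [k hk] := inv_succ_small e0.
apply: le_lt_trans (hk k (leqnn k)).
by apply: le_trans (rho_le k); exact: (st_diam (st k) (hx k) (hy k)).
Qed.

Definition address (x : sphere R) : nat -> bool :=
  fun k => `[< exists2 w, size w = k & cell k.+1 (true :: w) x >].

Lemma address_cell x : C x -> forall k, cell k (prefix_rev (address x) k) x.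
Proof.
move=> Cx; elim=> [|k IH].
  by have [w /size0nil ->] := Cx 0%N.
have [[//|b w] /= [wk] h] := Cx k.+1.
have wE : w = prefix_rev (address x) k.
  apply: (cell_inj st wk (size_prefix_rev _ k) (cell_sub lk wk h) IH).
suff bE : address x k = b by rewrite bE -wE.
case: b h => h; first by apply/asboolP; exists w.
apply/negP => /asboolP [w' w'k h'].
have [//] : true :: w' = false :: w.
by apply: (cell_inj st (k := k.+1) _ _ h' h); rewrite /= ?wk ?w'k.
Qed.

Lemma cell_prefix_inj t s k x : cell k (prefix_rev t k) x ->
  cell k (prefix_rev s k) x -> prefix_rev t k = prefix_rev s k.
Proof. by apply: (cell_inj st); exact: size_prefix_rev. Qed.

Lemma nbhs_prefix (t : cantor_space) k :
  nbhs t [set s : cantor_space | prefix_rev s k = prefix_rev t k].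
Proof.
elim: k => [|k IH]; first by apply: filterE.
have h : nbhs t [set s : cantor_space | s k = t k].
  by have := @proj_continuous nat (fun=> bool) k t _ (discrete_set1 (t k)).
by apply: filterS2 IH h => s /= -> ->.
Qed.

Lemma cantorC_cantor_set : cantor_set C.
Proof.
have /choice [f hf] : forall t : cantor_space, exists x, forall k, cell k (prefix_rev t k) x.
  by move=> t; exact: branch_exists.
have fC t : C (f t) by move=> k; exists (prefix_rev t k); [exact: size_prefix_rev|exact: hf].
have gf t : address (f t) = t.
  apply: prefix_rev_inj => k; apply: (cell_prefix_inj _ (hf t k)).
  exact: address_cell.
exists f; split.
- move=> t A /nbhs_sphereP [e e0 eA].
  have [d d0 hd] := chd_small_disc (f t) e0.
  have [d' d'0 hd'] := chd_small d0.
  (* Sequences sharing their first [k] bits are sent into one cell, of diameter at most [rho k]. *)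
  have [k hk] := inv_succ_small d'0.
  apply: filterS (nbhs_prefix t k) => s /= sE; apply/eA/hd/hd'.
  apply: le_lt_trans (hk k (leqnn k)); apply: le_trans (rho_le k).
  have := hf s k; rewrite sE => h; exact: (st_diam (st k) (hf t k) h).
- by move=> t s ts; rewrite -(gf t) -(gf s) ts.
- apply/seteqP; split=> [_ [t _ <-]//|x Cx]; exists (address x) => //.
  by apply: (branch_unique (hf _)); exact: address_cell.
- exists (address : sphere R -> cantor_space); split => //.
  apply/subspace_continuousP => x Cx.
  apply/cvg_sup => n U [V] [[W oW <-] WfN WU].
  (* Cells are open, and on [C] the first [n + 1] bits of the address are constant within a cell of
     level [n + 1]. *)
  have ox : nbhs x (cell n.+1 (prefix_rev (address x) n.+1)).
    by apply: open_nbhs_nbhs; split; [exact: disc_open (st_r (st _))|exact: address_cell].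
  suff : within C (nbhs x) [set y | U (address y)] by [].
  rewrite /within /=; apply: filterS ox => y cy Cy; apply: WU => /=.
  have := cell_prefix_inj (address_cell Cy n.+1) cy => /= -[-> _].
  exact: WfN.
Qed.

(** * Hausdorff measures and dimension zero *)

Lemma sdiam_cell k q : sdiam (disc q (r k)) <= rho R k.
Proof.
apply: ge_sup.
  have c := disc_center q (st_r (st k)).
  by exists (sdist q q), q, q.
by move=> _ [x [y [hx [hy ->]]]]; exact: (st_diam (st k) hx hy).
Qed.

Lemma sdiam_cell_ge0 k q : 0 <= sdiam (disc q (r k)).
Proof.
have c := disc_center q (st_r (st k)).
apply: le_trans (sdist_ge0 q q) _; apply: ub_le_sup.
  by exists pi => _ [x [y [_ [_ ->]]]]; exact: sdist_lepi.
by exists q, q.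
Qed.

Lemma sdiam0 : sdiam (set0 : set (sphere R)) = 0.
Proof.
rewrite /sdiam (_ : [set d | _] = set0) ?sup0//.
by apply/seteqP; split=> [d [x [y []]]|//].
Qed.

Lemma hterm_ge0 s (U : set (sphere R)) : 0 <= hterm s U.
Proof. by rewrite /hterm; case: asboolP => // _; exact: powR_ge0. Qed.

(** As [rho k <= 1], lowering the exponent from [s] to [1 / (k + 1)] increases the power, and there
    it equals [4^-k]. *)
Lemma hterm_cell s k q : k.+1%:R^-1 <= s -> hterm s (disc q (r k)) <= (4^-1) ^+ k.
Proof.
move=> ks; have s0 : 0 <= s by apply: le_trans ks; rewrite invr_ge0.
rewrite /hterm; case: asboolP => [_|_]; first by rewrite exprn_ge0// invr_ge0.
apply: (@le_trans _ _ (rho R k `^ s)).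
  apply: ge0_ler_powR => //; rewrite ?nnegrE; [exact: sdiam_cell_ge0|exact/ltW/rho_gt0|].
  exact: sdiam_cell.
apply: (@le_trans _ _ (rho R k `^ k.+1%:R^-1)).
  apply: ger_powR ks; rewrite rho_gt0/=; apply: le_trans (rho_le k) _.
  by rewrite invf_le1// ler1n.
rewrite /rho exprM -powR_mulrn ?exprn_ge0 ?invr_ge0// -powRrM mulfV ?pnatr_eq0//.
by rewrite powRr1// exprn_ge0// invr_ge0.
Qed.

Definition word k n : seq bool := nth [::] [seq tval w | w <- enum {: k.-tuple bool}] n.

Lemma wordP k w : size w = k -> exists2 n, (n < 2 ^ k)%N & word k n = w.
Proof.
move=> wk.
have : w \in [seq tval w | w <- enum {: k.-tuple bool}].
  apply/mapP; exists (tcast wk (in_tuple w)); first by rewrite mem_enum.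
  by rewrite val_tcast.
move=> wi; exists (index w [seq tval w | w <- enum {: k.-tuple bool}]).
  by rewrite -index_mem size_map -cardE card_tuple card_bool in wi.
by rewrite /word nth_index.
Qed.

(** Covers are infinite sequences, so the [2^k] cells are followed by empty sets, which [hterm]
    counts as 0. *)
Definition cover k n : set (sphere R) := if (n < 2 ^ k)%N then cell k (word k n) else set0.

Lemma cover_sub k : C `<=` \bigcup_n cover k n.
Proof.
move=> x /(_ k) [w /wordP [n nk <-] h]; exists n => //.
by rewrite /cover nk.
Qed.

Lemma cover_diam k n : sdiam (cover k n) <= rho R k.
Proof.
by rewrite /cover; case: ifP => _; [exact: sdiam_cell|rewrite sdiam0 ltW// rho_gt0].
Qed.

Lemma cover_sum k s : k.+1%:R^-1 <= s ->
  (\sum_(0 <= n <oo) (hterm s (cover k n))%:E <= (k.+1%:R^-1 : R)%:E)%E.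
Proof.
move=> ks; rewrite (nneseries_split 0 (2 ^ k)); last first.
  by move=> n _; rewrite lee_fin hterm_ge0.
rewrite add0n [X in (_ + X)%E]eseries0 ?adde0; last first.
  move=> n kn _; rewrite /cover ltnNge kn /= /hterm.
  by case: asboolP.
rewrite sumEFin lee_fin.
apply: (@le_trans _ _ (\sum_(0 <= n < 2 ^ k) (4^-1 : R) ^+ k)).
  by rewrite !big_nat; apply: ler_sum => n /= nk; rewrite /cover nk; exact: hterm_cell.
rewrite sumr_const_nat subn0 -[_ *+ (2 ^ k)]mulr_natr natrX.
apply: le_trans (ler_wpM2r _ (pow4_le k)) _; first by rewrite exprn_ge0.
by rewrite mulrAC -exprMn mulVf ?pnatr_eq0// expr1n mul1r.
Qed.

Lemma cantorC_hausdorff_dim : hausdorff_dim C = 0%E.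
Proof.
have H s : 0 < s -> hausdorff_measure s C = 0%E.
  move=> s0.
  have hd (d : R) : 0 < d -> hausdorff_delta s d C = 0%E.
    move=> d0; apply/eqP; rewrite eq_le; apply/andP; split; last first.
      apply/ereal_infP => _ [U _ <-]; apply: nneseries_ge0 => n _ _.
      by rewrite lee_fin hterm_ge0.
    apply/lee_addgt0Pr => e e0; rewrite add0e.
    have [k1 h1] := inv_succ_small s0; have [k2 h2] := inv_succ_small d0.
    have [k3 h3] := inv_succ_small e0.
    (* One level serves the exponent [s], the mesh [d] and the total [e], since [1 / (k + 1)]
       controls all three. *)
    pose k := maxn k1 (maxn k2 k3).
    have g1 := h1 k (leq_maxl _ _).
    have g2 : k.+1%:R^-1 < d by apply: h2; rewrite /k maxnCA leq_maxl.
    have g3 : k.+1%:R^-1 < e by apply: h3; rewrite /k !leq_max leqnn !orbT.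
    apply: ge_ereal_inf; eexists; first exists (cover k) => //.
      split; first exact: cover_sub.
      by move=> n; apply: le_trans (cover_diam k n) _; apply: le_trans (rho_le k) (ltW g2).
    apply: le_trans (cover_sum (ltW g1)) _; rewrite lee_fin; exact: ltW.
  rewrite /hausdorff_measure (_ : [set _ | _ in _] = [set 0%E]) ?ereal_sup1//.
  apply/seteqP; split=> [_ [d d0 <-]|_ ->] /=; first exact: hd.
  by exists 1 => //=; exact: hd.
apply/eqP; rewrite eq_le; apply/andP; split; last first.
  by apply/ereal_infP => _ [s [s0 _] <-]; rewrite lee_fin.
(* Every positive exponent has measure zero, so the infimum is at most any [e > 0]. *)
apply/lee_addgt0Pr => e e0; rewrite add0e; apply: ereal_inf_lbound.
by exists e => //; split; [exact: ltW|exact: H].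
Qed.

End CantorScheme.

Theorem theorem1p1 (R : realType) :
  exists (C : set (sphere R)) (gamma : sphere R -> CC R * CC R),
    [/\ cantor_set C,
        hausdorff_dim C = 0%E &
        proper_holomorphic_embedding (~` C) gamma].
Proof.
have [X [Y [p [r [delta [st lk delta1]]]]]] := @stages_exist R.
have [gamma hgamma] := embedding_exists st lk delta1.
exists (cantorC p r), gamma; split => //.
  exact: cantorC_cantor_set st lk.
exact: cantorC_hausdorff_dim st.
Qed.
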